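(* Suppose $\mathcal Q$ is vertically unbounded. Then $d=\min(B\setminus B^{unb})=\min(B^{ct})$.
   Context: Let $(K,v)$ be a valued field, $\Gamma$ the divisible hull of $vK$, embedded in a divisible ordered abelian group $\Lambda$. Let $\nu\colon K[x]\to\Lambda\cup\{\infty\}$ be a valuation extending $v$ which is well-specified, i.e. it is not the case that simultaneously $\nu^{-1}(\infty)=0$, the value group of $\nu$ modulo $\Gamma$ is torsion, and the residue field of $\nu$ is algebraic over that of $v$. For $s\ge0$ let $\partial_s$ be the $s$-th Hasse–Schmidt derivative, defined by $f(x+y)=\sum_{s\ge0}(\partial_sf)y^s$. For nonconstant $f$ with $\nu(f)<\infty$ the level is $\epsilon_\nu(f)=\max\{(\nu(f)-\nu(\partial_sf))/s: s\ge1\}$; $\epsilon_\nu(a)=-\infty$ for $a\in K$. A monic $Q\in K[x]$ is a key polynomial for $\nu$ if $\epsilon_\nu(f)<\epsilon_\nu(Q)$ whenever $\deg f<\deg Q$. For monic $Q$, each $f$ has a unique $Q$-expansion $f=\sum_{i\ge0}f_{Q,i}Q^i$ with $\deg f_{Q,i}<\deg Q$; set $\nu_Q(f)=\min_i\nu(f_{Q,i}Q^i)$, $S_Q(f)=\{i:\nu(f_{Q,i}Q^i)=\nu_Q(f)\}$, $\deg_Qf=\max S_Q(f)$. Fix $m\ge1$ such that the set $\Psi_m$ of key polynomials of degree $m$ for $\nu$ is nonempty and has no element of maximal $\nu$-value. Let $\mathcal Q\subseteq\Psi_m$ be well-ordered by $Q<R\iff\nu(Q)<\nu(R)$ and cofinal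 in $\Psi_m$ for $\nu$-values; write $\gamma_Q=\nu(Q)$. As in the paper, all values $\nu_Q(f)$ ($f\ne0$) lie in $\Gamma$. ''For all $Q$ large enough'' means for all $Q$ in a final segment of $\mathcal Q$; a family indexed by $\mathcal Q$ is ultimately constant if it is constant on a final segment. $f$ is $\mathcal Q$-stable if $\nu_Q(f)=\nu(f)$ for all $Q$ large enough, $\mathcal Q$-unstable otherwise. Assume unstable polynomials exist; limit key polynomials are the monic $\mathcal Q$-unstable polynomials of minimal degree, forming $\mathrm{KP}_\infty(\mathcal Q)$. For each $f$, $\deg_Qf$ is ultimately constant; for $f\in\mathrm{KP}_\infty(\mathcal Q)$ its ultimate value $d$ (independent of $f$) is the defect of $\mathcal Q$. Fix $F\in\mathrm{KP}_\infty(\mathcal Q)$, $D=\lfloor\deg F/m\rfloor$, $F=\sum_{\ell=0}^DF_{Q,\ell}Q^\ell$, $\beta_{Q,\ell}=\nu(F_{Q,\ell})\in\Gamma\cup\{\infty\}$. Let $\delta^L$ be the smallest initial segment of $\Gamma$ containing $\{\nu_Q(F):Q\in\mathcal Q\}$; write $x>\delta^L$ if $x\in(\Gamma\setminus\delta^L)\cup\{\infty\}$. Let $J$ be the set of $\ell\in\{0,\dots,D\}$ with $\beta_{Q,\ell}+\ell\gamma_Q>\delta^L$ for all $Q$ large enough, $B=\{0,\dots,D\}\setminus J$, and $B^{ct}$ the set of $\ell\in B$ for which $(\beta_{Q,\ell})_Q$ is ultimately constant. A cut $\eta=(\eta^L,\eta^R)$ of $\Gamma$ is vertically bounded if for every $x\in\eta^L$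 and rational $q>1$ there is $y\in\eta^L$ with $q(y-x)>z-x$ for all $z\in\eta^L$. Let $\gamma_{\mathcal Q}$ be the cut of $\Gamma$ whose lower set is the smallest initial segment containing $\{\gamma_Q\}$; $\mathcal Q$ is vertically unbounded if $\gamma_{\mathcal Q}$ is not vertically bounded. For $\ell\in\{0,\dots,D\}$, $\mathcal B_\ell$ is the smallest initial segment of $\Gamma$ containing all $\beta\in\Gamma$ such that $\beta+\ell\gamma_Q\in\delta^L$ for some $Q\in\mathcal Q$. $B^{unb}$ is the set of $\ell\in B$ such that for every $\beta\in\mathcal B_\ell$ one has $\beta_{Q,\ell}\ge\beta$ for all $Q$ large enough. *)

(* Defs.v *)
From HB Require Import structures.
From mathcomp Require Import all_boot all_order all_algebra.
Set Implicit Arguments. Unset Strict Implicit. Unset Printing Implicit Defensive.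
Import Order.TTheory GRing.Theory Num.Theory.
Local Open Scope ring_scope.

(* Values in Λ ∪ {∞} are represented by [option L], with [None] = ∞. *)
Section ExtValues.
Variable L : porderZmodType.

Definition ordered_divisible_group : Prop :=
  [/\ (forall x y : L, (x <= y) || (y <= x)),
      (forall x y z : L, x <= y -> x + z <= y + z) &
      (forall (n : nat) (x : L), (0 < n)%N -> exists y : L, y *+ n = x)].

Definition leo (a b : option L) : bool :=
  match b, a with
  | None, _ => true
  | Some _, None => false
  | Some y, Some x => x <= y
  end.
Definition lto (a b : option L) : bool := leo a b && (a != b).
Definition addo (a b : option L) : option L :=
  match a, b with Some x, Some y => Some (x + y) | _, _ => None end.
Definition mulno (a : option L) (n : nat) : option L :=
  match a with Some x => Some (x *+ n) | None => None end.
Definition mino (a b : option L) : option L := if leo a b then a else b.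
End ExtValues.

Section Valuations.
Variables (K : fieldType) (L : porderZmodType).

Definition field_valuation (v : K -> option L) : Prop :=
  [/\ forall a, v a = None <-> a = 0,
      v 1 = Some 0,
      forall a b, v (a * b) = addo (v a) (v b) &
      forall a b, leo (mino (v a) (v b)) (v (a + b))].

(* Γ : the divisible hull of vK inside Λ *)
Definition Gamma (v : K -> option L) (x : L) : Prop :=
  exists (n : nat) (a : K), (0 < n)%N /\ v a = Some (x *+ n).

(* nu : K[x] -> Λ ∪ {∞} is a valuation (possibly with nonzero support)
   extending v *)
Definition poly_valuation (v : K -> option L) (nu : {poly K} -> option L) : Prop :=
  [/\ nu 0 = None,
      nu 1 = Some 0,
      forall f g, nu (f * g) = addo (nu f) (nu g),
      forall f g, leo (mino (nu f) (nu g)) (nu (f + g)) &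
      forall c : K, nu c%:P = v c].

(* The residue field of nu is algebraic over the residue field of v:
   every residue class of f/g with nu f = nu g (finite) is a root of a
   nonzero polynomial with coefficients in the residue field of v. *)
Definition residue_algebraic (v : K -> option L) (nu : {poly K} -> option L) : Prop :=
  forall (f g : {poly K}) (x : L), nu f = Some x -> nu g = Some x ->
    exists p : {poly K},
      [/\ forall i, leo (Some 0) (v p`_i),
          exists i, v p`_i = Some 0 &
          lto (Some (x *+ (size p).-1))
              (nu (\sum_(i < size p) (p`_i)%:P * f ^+ i * g ^+ ((size p).-1 - i)%N))].

Definition well_specified (v : K -> option L) (nu : {poly K} -> option L) : Prop :=
  ~ [/\ (forall f, nu f = None -> f = 0),
        (forall f g x y, nu f = Some x -> nu g = Some y ->
            exists n : nat, (0 < n)%N /\ Gamma v ((x - y) *+ n)) &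
        residue_algebraic v nu].

(* Levels, via Hasse–Schmidt derivatives  f^`N(s)  (coefficientwise
   (f^`N(s))`_i = f`_(s+i) * 'C(s+i,s), i.e. f(x+y) = sum_s f^`N(s) y^s).
   level_lt nu f Q  means  eps(f) < eps(Q), where
   eps(f) = max_{s>=1} (nu f - nu (f^`N(s)))/s, terms with nu(f^`N(s)) = ∞
   being -∞ (so eps(a) = -∞ for constants a).  Fractions are compared
   by cross-multiplication (Λ is torsion free). *)
Definition level_lt (nu : {poly K} -> option L) (f Q : {poly K}) : Prop :=
  exists (s' : nat) (a b : L),
    [/\ (0 < s')%N, nu Q = Some a, nu (Q^`N(s')) = Some b &
        forall (s : nat) (e c : L), (0 < s)%N -> nu f = Some e ->
          nu (f^`N(s)) = Some c -> (e - c) *+ s' < (a - b) *+ s].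

Definition key_poly (nu : {poly K} -> option L) (Q : {poly K}) : Prop :=
  Q \is monic /\ forall f : {poly K}, (size f < size Q)%N -> level_lt nu f Q.

Definition Psi (nu : {poly K} -> option L) (m : nat) (Q : {poly K}) : Prop :=
  key_poly nu Q /\ (size Q).-1 = m.

(* Q-expansion f = sum_i f_{Q,i} Q^i (Q monic) *)
Definition qcoef (Q f : {poly K}) (i : nat) : {poly K} := (f %/ Q ^+ i) %% Q.
Definition nuQ (nu : {poly K} -> option L) (Q f : {poly K}) : option L :=
  \big[@mino L/None]_(i < size f) nu (qcoef Q f i * Q ^+ i).
Definition degQ (nu : {poly K} -> option L) (Q f : {poly K}) : nat :=
  \max_(i < size f | nu (qcoef Q f i * Q ^+ i) == nuQ nu Q f) (i : nat).

Section Family.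
Variables (v : K -> option L) (nu : {poly K} -> option L)
          (m : nat) (Qs : {poly K} -> Prop).

Definition eventually (P : {poly K} -> Prop) : Prop :=
  exists Q0, Qs Q0 /\ forall Q, Qs Q -> leo (nu Q0) (nu Q) -> P Q.
Definition ult_const (T : Type) (g : {poly K} -> T) : Prop :=
  exists Q0, Qs Q0 /\ forall Q, Qs Q -> leo (nu Q0) (nu Q) -> g Q = g Q0.

Definition well_ordered_by_value : Prop :=
  (forall Q R, Qs Q -> Qs R -> nu Q = nu R -> Q = R) /\
  (forall P : {poly K} -> Prop, (forall Q, P Q -> Qs Q) -> (exists Q, P Q) ->
     exists Q0, P Q0 /\ forall Q, P Q -> leo (nu Q0) (nu Q)).

Definition stable (f : {poly K}) : Prop := eventually (fun Q => nuQ nu Q f = nu f).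

Definition KP_inf (F : {poly K}) : Prop :=
  [/\ F \is monic, ~ stable F &
      forall g : {poly K}, g \is monic -> ~ stable g -> (size F <= size g)%N].

(* vertically bounded cuts (given by their lower set etaL) *)
Definition vert_bounded (etaL : L -> Prop) : Prop :=
  forall x, etaL x -> forall q : rat, 1 < q ->
    exists y, etaL y /\ forall z, etaL z -> (z - x) *~ denq q < (y - x) *~ numq q.

Definition gammaQs_L (x : L) : Prop :=
  Gamma v x /\ exists Q, Qs Q /\ leo (Some x) (nu Q).
Definition vert_unbounded : Prop := ~ vert_bounded gammaQs_L.

Variable F : {poly K}.
Definition Dbound : nat := ((size F).-1 %/ m)%N.
Definition beta (Q : {poly K}) (l : nat) : option L := nu (qcoef Q F l).
Definition deltaL (x : L) : Prop :=
  Gamma v x /\ exists Q, Qs Q /\ leo (Some x) (nuQ nu Q F).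
Definition above_deltaL (o : option L) : Prop :=
  match o with None => True | Some x => Gamma v x /\ ~ deltaL x end.
Definition Jset (l : nat) : Prop :=
  (l <= Dbound)%N /\
  eventually (fun Q => above_deltaL (addo (beta Q l) (mulno (nu Q) l))).
Definition Bset (l : nat) : Prop := (l <= Dbound)%N /\ ~ Jset l.
Definition Bct (l : nat) : Prop := Bset l /\ ult_const (fun Q => beta Q l).
Definition Bl (l : nat) (b' : L) : Prop :=
  Gamma v b' /\ exists (b g : L) (Q : {poly K}),
    [/\ Gamma v b, Qs Q, nu Q = Some g, deltaL (b + g *+ l) & b' <= b].
Definition Bunb (l : nat) : Prop :=
  Bset l /\ forall b, Bl l b -> eventually (fun Q => leo (Some b) (beta Q l)).
End Family.

Definition is_min (S : nat -> Prop) (n : nat) : Prop :=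
  S n /\ forall k, S k -> (n <= k)%N.

End Valuations.

(* Main.v *)
(* For key polynomials Q <= R of degree m, a product of two polynomials of degree
   < m divided by R has a quotient of value greater than that of the product
   minus nu(Q). Rewriting a Q-expansion as an R-expansion therefore preserves the
   part of least weight, so deg_Q F decreases to an ultimate value d, the
   coefficient of Q^d ultimately has constant value b_d, and nu_Q(F) = b_d + d g_Q
   with g_Q = nu(Q). Hence d is in Bct, and Bct is disjoint from Bunb because
   nu_Q(F) has no maximum.

   It remains to see that l < d in B lies in Bunb. One has
   nu(F_{Q,l}) >= b_d + (d - l) g_Q. If the g_Q get d times further from the least
   one, g_0, than any given one, this bound is enough. Otherwise vertical
   unboundedness at a large base point makes the later differences g_R - g_Q
   infinitely small with respect to g_Q - g_0, so that all carries lie above delta.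
   Up to such carries F_{R,l} is the constant R-coefficient of the l-th Hasse
   derivative of F with respect to Q, a polynomial of degree < deg F and hence
   stable if l > 0. So nu(F_{R,l}) is ultimately constant, which contradicts
   vertical unboundedness. *)
Require Import Defs.
From HB Require Import structures.
From mathcomp Require Import all_boot all_order all_algebra.
From mathcomp Require Import ring zify.
From Stdlib Require Import Classical.
Set Implicit Arguments. Unset Strict Implicit. Unset Printing Implicit Defensive.
Import Order.TTheory GRing.Theory Num.Theory.
Local Open Scope ring_scope.

(* The square-zero extension [int (+) V] embeds the additive group [V] into a
   commutative ring, so that [ring] decides identities of [V]. *)
Definition sqzero (V : zmodType) : Type := (int * V)%type.
HB.instance Definition _ (V : zmodType) := GRing.Zmodule.on (sqzero V).

Section SquareZero.
Variable V : zmodType.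

Definition sqz_mul (a b : sqzero V) : sqzero V :=
  (a.1 * b.1, b.2 *~ a.1 + a.2 *~ b.1).
Definition sqz_one : sqzero V := (1, 0).

Fact sqz_mulA : associative sqz_mul.
Proof.
move=> [a x] [b y] [c z]; rewrite /sqz_mul /=; congr pair; first by rewrite mulrA.
by rewrite !mulrzDl -!mulrzA addrA [b * a]mulrC [a * c]mulrC.
Qed.
Fact sqz_mulC : commutative sqz_mul.
Proof. by move=> a b; rewrite /sqz_mul mulrC addrC. Qed.
Fact sqz_mul1 : left_id sqz_one sqz_mul.
Proof. by move=> [b y]; rewrite /sqz_mul /= mul1r mulr1z mul0rz addr0. Qed.
Fact sqz_mulDl : left_distributive sqz_mul +%R.
Proof.
move=> [a x] [b y] [c z]; rewrite /sqz_mul /=; congr pair; first by rewrite mulrDl.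
by rewrite /= mulrzDr mulrzDl addrACA.
Qed.
Fact sqz_one_neq0 : sqz_one != 0.
Proof. by []. Qed.

HB.instance Definition _ := GRing.Zmodule_isComNzRing.Build (sqzero V)
  sqz_mulA sqz_mulC sqz_mul1 sqz_mulDl sqz_one_neq0.

Definition sqz_in (x : V) : sqzero V := (0, x).
Fact sqz_in_is_additive : zmod_morphism sqz_in.
Proof. by move=> x y; rewrite /sqz_in; congr pair; rewrite subr0. Qed.
HB.instance Definition _ := GRing.isZmodMorphism.Build V (sqzero V) sqz_in
  sqz_in_is_additive.

Lemma sqz_in_inj : injective sqz_in.
Proof. by move=> x y []. Qed.
End SquareZero.

Ltac zring := apply: sqz_in_inj; ring.

(** * Totally ordered divisible groups *)

Section OrderedGroup.
Variables (L : porderZmodType) (hL : ordered_divisible_group L).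
Implicit Types x y z : L.

Lemma og_le_total x y : (x <= y) || (y <= x).
Proof. by case: hL. Qed.

Lemma og_leP x y : {x <= y} + {y < x}.
Proof.
case xy: (x <= y); [by left | right].
move: (og_le_total x y); rewrite xy /= lt_neqAle => ->; rewrite andbT.
by apply/eqP=> e; rewrite e lexx in xy.
Qed.

Lemma og_subge0 x y : (0 <= y - x) = (x <= y).
Proof.
case: hL => _ hD _; apply/idP/idP => [/(hD _ _ x)|/(hD _ _ (- x))].
  by rewrite add0r subrK.
by rewrite subrr.
Qed.

Lemma og_subgt0 x y : (0 < y - x) = (x < y).
Proof. by rewrite !lt_neqAle og_subge0 -(inj_eq (addIr x)) add0r subrK. Qed.

Lemma og_addge0 x y : 0 <= x -> 0 <= y -> 0 <= x + y.
Proof.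
move=> hx hy; case: hL => _ /(_ _ _ y hx) hD _.
by rewrite (le_trans hy) // -[X in X <= _]add0r.
Qed.

Lemma og_addgt0l x y : 0 < x -> 0 <= y -> 0 < x + y.
Proof. by move=> hx hy; apply: le_lt_trans hy _; rewrite -og_subgt0 addrK. Qed.

Lemma og_addgt0r x y : 0 <= x -> 0 < y -> 0 < x + y.
Proof. by move=> hx hy; rewrite addrC og_addgt0l. Qed.

Lemma og_mulrn_ge0 x n : 0 <= x -> 0 <= x *+ n.
Proof. by move=> hx; elim: n => // n IHn; rewrite mulrS og_addge0. Qed.

Lemma og_mulrn_gt0 x n : 0 < x -> 0 < x *+ n.+1.
Proof. by move=> hx; rewrite mulrS og_addgt0l // og_mulrn_ge0 // ltW. Qed.

Lemma og_le u x y : 0 <= u -> y - x = u -> x <= y.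
Proof. by move=> hu e; rewrite -og_subge0 e. Qed.

Lemma og_lt u x y : 0 < u -> y - x = u -> x < y.
Proof. by move=> hu e; rewrite -og_subgt0 e. Qed.

Lemma og_le_eq x y : x = y -> x <= y.
Proof. by move=> ->. Qed.

Lemma og_mulrn_le n x y : (0 < n)%N -> x *+ n <= y *+ n -> x <= y.
Proof.
case: n => // n _ h; case: (og_leP x y) => //; rewrite -og_subgt0.
by move=> /(@og_mulrn_gt0 _ n); rewrite mulrnBl og_subgt0 => /lt_geF; rewrite h.
Qed.

Lemma og_mulrn_lt n x y : x *+ n < y *+ n -> x < y.
Proof.
move=> h; case: (og_leP y x) => //; rewrite -og_subge0.
by move=> /(@og_mulrn_ge0 _ n); rewrite mulrnBl og_subge0 => /le_gtF; rewrite h.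
Qed.

Lemma og_mulrn_inj n x y : (0 < n)%N -> x *+ n = y *+ n -> x = y.
Proof. by move=> n0 e; apply/le_anti/andP; split; apply: (og_mulrn_le n0); rewrite e. Qed.

Lemma og_div n x : (0 < n)%N -> exists y, y *+ n = x.
Proof. by case: hL => _ _ h; apply: h. Qed.
End OrderedGroup.

(** A syntactic sign check: sums and multiples are split until each leaf is an assumed inequality or
    closes trivially. *)
Ltac og_pos hL := lazymatch goal with
  | |- is_true (0 < _ - _) => rewrite (og_subgt0 hL); done
  | |- is_true (0 <= _ - _) => rewrite (og_subge0 hL); solve [done | exact: ltW]
  | |- is_true (0 < _ + _) => first
      [ apply: (og_addgt0l hL); og_pos hL | apply: (og_addgt0r hL); og_pos hL ]
  | |- is_true (0 <= _ + _) => apply: (og_addge0 hL); og_pos hL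
  | |- is_true (0 < _ *+ _) => apply: (og_mulrn_gt0 hL); og_pos hL
  | |- is_true (0 <= _ *+ _) => apply: (og_mulrn_ge0 hL); og_pos hL
  | |- _ => solve [done | exact: ltW]
  end.

(* [u] is a manifestly nonnegative expression equal to [y - x] for the goal
   [x <= y] or [x < y]. *)
Ltac og_by hL u :=
  first [apply: (@og_lt _ hL u) | apply: (@og_le _ hL u)];
  [ by og_pos hL | by zring ].

(** * Finite lower bounds for values that may be infinite *)

Section ExtendedValues.
Variables (L : porderZmodType) (hL : ordered_divisible_group L).
Implicit Types (x y b c : L) (o p : option L).

(** The bound is always finite, so it can be added and subtracted freely; an infinite value
    satisfies every bound, strict or not. *)
Definition oge b o : bool := leo (Some b) o.
Definition ogt b o : bool := lto (Some b) o.
Arguments oge : simpl never.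
Arguments ogt : simpl never.

Lemma oge_some b x : oge b (Some x) = (b <= x). Proof. by []. Qed.
Lemma ogt_some b x : ogt b (Some x) = (b < x).
Proof. by rewrite /ogt /lto /leo lt_neqAle andbC. Qed.
Lemma ogtW b o : ogt b o -> oge b o.
Proof. by case/andP. Qed.
Lemma oge_trans b c o : c <= b -> oge b o -> oge c o.
Proof. by case: o => [x|] // cb; rewrite !oge_some; apply: le_trans. Qed.
Lemma oge_ogt b c o : c < b -> oge b o -> ogt c o.
Proof. by case: o => [x|] // cb; rewrite oge_some ogt_some; apply: lt_le_trans. Qed.
Lemma ogt_trans b c o : c <= b -> ogt b o -> ogt c o.
Proof. by case: o => [x|] // cb; rewrite !ogt_some; apply: le_lt_trans. Qed.
Lemma ogtPn b o : ~~ ogt b o -> exists2 x, o = Some x & x <= b.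
Proof.
case: o => [x|] //; rewrite ogt_some => h; exists x => //.
by case: (og_leP hL x b) => // /(negP h).
Qed.
Lemma oge_addo b c o p : oge b o -> oge c p -> oge (b + c) (addo o p).
Proof.
case: o p => [x|] [y|] //=; rewrite !oge_some => h1 h2.
by og_by hL ((x - b) + (y - c)).
Qed.
Lemma ogt_addo b c o p : ogt b o -> oge c p -> ogt (b + c) (addo o p).
Proof.
case: o p => [x|] [y|] //=; rewrite !oge_some !ogt_some => h1 h2.
by og_by hL ((x - b) + (y - c)).
Qed.
Lemma leo_total o p : leo o p || leo p o.
Proof. by case: o p => [x|] [y|] //=; apply: og_le_total. Qed.
Lemma leo_trans o p q : leo o p -> leo p q -> leo o q.
Proof. by case: o p q => [x|] [y|] [z|] //=; apply: le_trans. Qed.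
Lemma leo_refl o : leo o o.
Proof. by case: o => //= x. Qed.
Lemma oge_mino b o p : oge b o -> oge b p -> oge b (mino o p).
Proof. by rewrite /mino; case: ifP. Qed.
Lemma ogt_mino b o p : ogt b o -> ogt b p -> ogt b (mino o p).
Proof. by rewrite /mino; case: ifP. Qed.
Lemma mino_lel o p : leo (mino o p) o.
Proof. by rewrite /mino; case: ifP (leo_total o p) => [_ _|_ /= //]; apply: leo_refl. Qed.
Lemma mino_ler o p : leo (mino o p) p.
Proof. by rewrite /mino; case: ifP => // _; apply: leo_refl. Qed.
Lemma oge_leo b o p : oge b o -> leo o p -> oge b p.
Proof. exact: leo_trans. Qed.
Lemma ogt_leo b o p : ogt b o -> leo o p -> ogt b p.
Proof. by case: o p => [x|] [y|] //=; rewrite !ogt_some; apply: lt_le_trans. Qed.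
End ExtendedValues.
Arguments oge {L} b o : simpl never.
Arguments ogt {L} b o : simpl never.

(** * Valuations on $K[x]$ and the group $\Gamma$ *)

Section PolyValuation.
Variables (K : fieldType) (L : porderZmodType) (hL : ordered_divisible_group L).
Variables (v : K -> option L) (nu : {poly K} -> option L).
Hypotheses (hv : field_valuation v) (hnu : poly_valuation v nu).
Implicit Types (f g h : {poly K}) (b c x y : L).

Lemma nu0 : nu 0 = None. Proof. by case: hnu. Qed.
Lemma nu1 : nu 1 = Some 0. Proof. by case: hnu. Qed.
Lemma nuM f g : nu (f * g) = addo (nu f) (nu g). Proof. by case: hnu. Qed.
Lemma nuC a : nu a%:P = v a. Proof. by case: hnu. Qed.

Lemma nuN f : nu (- f) = nu f.
Proof.
have nuN1 : nu (- 1) = Some 0.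
  have := nuM (- 1) (- 1); rewrite mulrNN mulr1 nu1; case: (nu _) => //= x [].
  by rewrite -mulr2n => /esym e; congr Some; apply: (@og_mulrn_inj _ hL 2); rewrite ?mul0rn.
by rewrite -mulN1r nuM nuN1; case: (nu f) => //= x; rewrite add0r.
Qed.

Lemma oge_nu0 b : oge b (nu 0). Proof. by rewrite nu0. Qed.
Lemma ogt_nu0 b : ogt b (nu 0). Proof. by rewrite nu0. Qed.

Lemma oge_nuD b f g : oge b (nu f) -> oge b (nu g) -> oge b (nu (f + g)).
Proof.
move=> hf hg; have [_ _ _ /(_ f g) hD _] := hnu.
exact: oge_leo (oge_mino hf hg) hD.
Qed.

Lemma ogt_nuD b f g : ogt b (nu f) -> ogt b (nu g) -> ogt b (nu (f + g)).
Proof.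
move=> hf hg; have [_ _ _ /(_ f g) hD _] := hnu.
exact: ogt_leo (ogt_mino hf hg) hD.
Qed.

Lemma oge_nuB b f g : oge b (nu f) -> oge b (nu g) -> oge b (nu (f - g)).
Proof. by move=> hf hg; apply: oge_nuD; rewrite ?nuN. Qed.

Lemma ogt_nuB b f g : ogt b (nu f) -> ogt b (nu g) -> ogt b (nu (f - g)).
Proof. by move=> hf hg; apply: ogt_nuD; rewrite ?nuN. Qed.

Lemma oge_nu_sum I (r : seq I) (P : pred I) b (F : I -> {poly K}) :
  (forall i, P i -> oge b (nu (F i))) -> oge b (nu (\sum_(i <- r | P i) F i)).
Proof. by move=> h; elim/big_ind: _ => //; [apply: oge_nu0 | move=> *; apply: oge_nuD]. Qed.

Lemma ogt_nu_sum I (r : seq I) (P : pred I) b (F : I -> {poly K}) :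
  (forall i, P i -> ogt b (nu (F i))) -> ogt b (nu (\sum_(i <- r | P i) F i)).
Proof. by move=> h; elim/big_ind: _ => //; [apply: ogt_nu0 | move=> *; apply: ogt_nuD]. Qed.

Lemma oge_nuM b c f g : oge b (nu f) -> oge c (nu g) -> oge (b + c) (nu (f * g)).
Proof. by rewrite nuM; apply: oge_addo. Qed.

Lemma ogt_nuM b c f g : ogt b (nu f) -> oge c (nu g) -> ogt (b + c) (nu (f * g)).
Proof. by rewrite nuM; apply: ogt_addo. Qed.

Lemma ogt_nuMr b c f g : oge b (nu f) -> ogt c (nu g) -> ogt (b + c) (nu (f * g)).
Proof. by move=> hf hg; rewrite mulrC addrC; apply: ogt_nuM. Qed.

Lemma nuX b f n : nu f = Some b -> nu (f ^+ n) = Some (b *+ n).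
Proof.
move=> h; elim: n => [|n IHn]; first by rewrite nu1 mulr0n.
by rewrite exprS mulrS nuM h IHn.
Qed.

Lemma oge_nuMn b f n : oge b (nu f) -> oge b (nu (f *+ n)).
Proof.
move=> h; elim: n => [|n IHn]; first by rewrite mulr0n oge_nu0.
by rewrite mulrS; apply: oge_nuD.
Qed.

(** A strictly larger value of the sum would carry over to $f = (f+g) - g$. *)
Lemma nuD_eq b f g : nu f = Some b -> ogt b (nu g) -> nu (f + g) = Some b.
Proof.
move=> hf hg; have hfg : oge b (nu (f + g)).
  by apply: oge_nuD; [rewrite hf oge_some | apply: ogtW].
case: (boolP (ogt b (nu (f + g)))) => [h|/(ogtPn hL)[x ex xb]].
  by have := ogt_nuB h hg; rewrite addrK hf ogt_some ltxx.
by move: hfg; rewrite ex oge_some => bx; congr Some; apply/le_anti/andP.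
Qed.

Lemma nu_near b f g : nu f = Some b -> ogt b (nu (g - f)) -> nu g = Some b.
Proof. by move=> hf /(nuD_eq hf); rewrite addrC subrK. Qed.

Lemma nu_const_finite a : a != 0 -> exists x, nu a%:P = Some x.
Proof.
move=> a0; rewrite nuC; case e: (v a) => [x|]; first by exists x.
by case: hv => /(_ a)[/(_ e) ea]; rewrite ea eqxx in a0.
Qed.

Lemma GammaD x y : Gamma v x -> Gamma v y -> Gamma v (x + y).
Proof.
case: hv => _ _ vM _ [n [a [n0 ea]]] [k [c [k0 ec]]].
have vX z t j : v z = Some t -> v (z ^+ j) = Some (t *+ j).
  by move=> ez; rewrite -nuC rmorphXn /=; apply: nuX; rewrite nuC.
exists (n * k)%N, (a ^+ k * c ^+ n); split; first by rewrite muln_gt0 n0.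
by rewrite vM (vX _ _ _ ea) (vX _ _ _ ec) /=; congr Some; zring.
Qed.

Lemma GammaN x : Gamma v x -> Gamma v (- x).
Proof.
case: hv => v0 v1 vM _ [n [a [n0 ea]]]; exists n, a^-1; split => //.
have a0 : a != 0 by apply/eqP => e; have /v0 : a = 0 by []; rewrite ea.
have := vM a a^-1; rewrite divff // v1 ea; case: (v a^-1) => //= y [e].
by congr Some; apply/eqP; rewrite mulNrn -addr_eq0 addrC -e.
Qed.

Lemma GammaB x y : Gamma v x -> Gamma v y -> Gamma v (x - y).
Proof. by move=> hx hy; apply: GammaD => //; apply: GammaN. Qed.

Lemma Gamma0 : Gamma v 0.
Proof. by exists 1%N, 1; split=> //; case: hv. Qed.

Lemma GammaMn x n : Gamma v x -> Gamma v (x *+ n).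
Proof. by move=> hx; elim: n => [|n IHn]; [apply: Gamma0 | rewrite mulrS; apply: GammaD]. Qed.

Lemma Gamma_div x n : (0 < n)%N -> Gamma v (x *+ n) -> Gamma v x.
Proof.
move=> n0 [k [a [k0 ea]]]; exists (n * k)%N, a.
by rewrite muln_gt0 n0 mulrnA.
Qed.
End PolyValuation.

(** * Arithmetic of $R$-expansions *)

Section Expansion.
Variable (K : fieldType).
Implicit Types (f g a R : {poly K}) (i n : nat).

Lemma qcoef0E R f : qcoef R f 0 = f %% R.
Proof. by rewrite /qcoef expr0 divp1. Qed.

Lemma qcoefSE R f i : qcoef R f i.+1 = qcoef R (f %/ R) i.
Proof. by rewrite /qcoef exprS divp_divl. Qed.

Lemma qcoefD R f g i : qcoef R (f + g) i = qcoef R f i + qcoef R g i.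
Proof. by rewrite /qcoef divpD modpD. Qed.

Lemma qcoefN R f i : qcoef R (- f) i = - qcoef R f i.
Proof. by rewrite /qcoef divpN modpN. Qed.

Lemma qcoefB R f g i : qcoef R (f - g) i = qcoef R f i - qcoef R g i.
Proof. by rewrite qcoefD qcoefN. Qed.

Lemma qcoefZ R f c i : qcoef R (c *: f) i = c *: qcoef R f i.
Proof. by rewrite /qcoef divpZl modpZl. Qed.

Lemma qcoef0 R i : qcoef R 0 i = 0.
Proof. by rewrite /qcoef div0p mod0p. Qed.

Lemma qcoef_sum R I (r : seq I) (P : pred I) (F : I -> {poly K}) i :
  qcoef R (\sum_(j <- r | P j) F j) i = \sum_(j <- r | P j) qcoef R (F j) i.
Proof.
by elim/big_rec2: _ => [|j x y _ <-]; rewrite ?qcoef0 ?qcoefD.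
Qed.

Lemma qcoef_small R f i : (size f < size R)%N ->
  qcoef R f i = if i is 0%N then f else 0.
Proof.
move=> hf; case: i => [|i]; first by rewrite qcoef0E modp_small.
by rewrite qcoefSE divp_small // qcoef0.
Qed.

Lemma qcoef_mulR0 R f : qcoef R (f * R) 0 = 0.
Proof. by rewrite qcoef0E modp_mull. Qed.

Lemma qcoef_mulRS R f i : R != 0 -> qcoef R (f * R) i.+1 = qcoef R f i.
Proof. by move=> R0; rewrite qcoefSE mulpK. Qed.

Lemma qcoef_mulRX R f n i : R != 0 ->
  qcoef R (f * R ^+ n) i = if (n <= i)%N then qcoef R f (i - n) else 0.
Proof.
move=> R0; elim: n i => [|n IHn] i; first by rewrite mulr1 subn0.
by rewrite exprSr mulrA; case: i => [|i]; rewrite ?qcoef_mulR0 // qcoef_mulRS // IHn.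
Qed.

Lemma size_qcoef R f i : R != 0 -> (size (qcoef R f i) < size R)%N.
Proof. by move=> R0; rewrite ltn_modp. Qed.

Lemma qcoef_eq0 R f i : (1 < size R)%N -> ((size f).-1 < (size R).-1 * i)%N ->
  qcoef R f i = 0.
Proof.
move=> R1; elim: i f => [|i IHi] f; first by rewrite muln0.
rewrite mulnS => h; rewrite qcoefSE; case: (leqP (size R) (size f)) => hs.
  have R0 : R != 0 by rewrite -size_poly_gt0; lia.
  apply: IHi; rewrite size_divp //.
  by move: (size R) (size f) (_ * i)%N h hs R1 => r s k; lia.
by rewrite divp_small // qcoef0.
Qed.

Lemma qcoef_ge_size R f i : (1 < size R)%N -> (size f <= i)%N -> qcoef R f i = 0.
Proof.
case: i => [|i] R1 hf; last by apply: qcoef_eq0; nia.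
by move: hf; rewrite leqn0 size_poly_eq0 => /eqP ->; apply: qcoef0.
Qed.

Lemma qcoef_expansion R f n : (1 < size R)%N -> (size f <= n)%N ->
  f = \sum_(i < n) qcoef R f i * R ^+ i.
Proof.
move=> R1; elim: n f => [|n IHn] f hf.
  by move: hf; rewrite leqn0 size_poly_eq0 big_ord0 => /eqP.
rewrite big_ord_recl qcoef0E expr0 mulr1.
under eq_bigr => i _ do rewrite lift0 qcoefSE exprSr mulrA.
rewrite -mulr_suml -IHn 1?addrC -?divp_eq //.
rewrite size_divp -?size_poly_gt0; last exact: ltnW.
by move: (size R) (size f) R1 hf => r s; lia.
Qed.

(** Each coefficient times $a$ has degree less than $2\deg R$, so its quotient by $R$ is again a
    coefficient and carries propagate one place only. *)
Lemma qcoef_mul_small R f a i : (size a < size R)%N ->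
  qcoef R (f * a) i = (qcoef R f i * a) %% R +
    (if i is j.+1 then (qcoef R f j * a) %/ R else 0).
Proof.
move=> ha; have R0 : R != 0 by rewrite -size_poly_gt0; lia.
elim: i f => [|i IHi] f.
  by rewrite addr0 !qcoef0E [in RHS]mulrC modp_mul mulrC.
have hc : (size ((f %% R * a) %/ R)%R < size R)%N.
  have hr : (size (f %% R)%R < size R)%N by rewrite ltn_modp.
  rewrite size_divp //; have := size_polyMleq (f %% R) a.
  by move: (size R) (size a) (size (f %% R)) (size (_ * a)) ha hr => r s t u; lia.
have e : (f * a) %/ R = (f %/ R) * a + (f %% R * a) %/ R.
  by rewrite {1}(divp_eq f R) mulrDl divpD mulrAC mulpK.
rewrite qcoefSE e qcoefD IHi (qcoef_small _ hc) qcoefSE -addrA; congr (_ + _).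
by case: i {IHi} => [|j]; rewrite ?addr0 -?qcoefSE // add0r qcoef0E.
Qed.
End Expansion.

(** * Hasse derivatives and leading coefficients *)

(** Leibniz rule, by induction on $f$ through $f X + c$. *)
Lemma nderivnM (R : comNzRingType) (f g : {poly R}) s :
  (f * g)^`N(s) = \sum_(i < s.+1) f^`N(i) * g^`N(s - i).
Proof.
elim/poly_ind: f s => [|f c IHf] s.
  by rewrite mul0r big1 ?linear0 // => i _; rewrite linear0 mul0r.
case: s => [|s]; first by rewrite big_ord1 !nderivn0.
have -> : (f * 'X + c%:P) * g = f * g * 'X + 0%:P + c *: g.
  by rewrite polyC0 addr0 mulrDl -mul_polyC mulrAC.
rewrite nderivnD nderivnMXaddC linearZ big_ord_recl nderivn0 subn0.
under eq_bigr => i _ do rewrite lift0 nderivnMXaddC mulrDl subSS.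
rewrite big_split /= -IHf.
have -> : (f * g)^`N(s.+1) = f * g^`N(s.+1) + \sum_(i < s.+1) f^`N(i.+1) * g^`N(s - i).
  by rewrite IHf big_ord_recl nderivn0 subn0; congr (_ + _); apply: eq_bigr.
under [X in _ = _ + (_ + X)]eq_bigr => i _ do rewrite mulrAC.
by rewrite -mulr_suml -mul_polyC; ring.
Qed.

Lemma nderivn_lead (R : nzRingType) (f : {poly R}) :
  f^`N((size f).-1) = (lead_coef f)%:P.
Proof.
apply/polyP => i; rewrite coef_nderivn coefC lead_coefE.
case: i => [|i]; first by rewrite addn0 binn mulr1n.
by rewrite nth_default ?mul0rn //; case: (size f) => [|k]; rewrite //= addnS ltnS leq_addr.
Qed.

Lemma size_monicB (R : nzRingType) (f g : {poly R}) : f \is monic -> g \is monic ->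
  size f = size g -> (size (g - f)%R < size g)%N.
Proof.
move=> mf mg sfg; have g0 : (0 < size g)%N by rewrite size_poly_gt0 monic_neq0.
have : (size (g - f)%R <= size g)%N.
  by apply: leq_trans (size_polyD _ _) _; rewrite size_polyN sfg maxnn.
rewrite leq_eqVlt => /orP[/eqP eS|//].
have : lead_coef (g - f) = 0.
  rewrite lead_coefE eS coefB -{2}sfg -!lead_coefE.
  by move/monicP: mf => ->; move/monicP: mg => ->; rewrite subrr.
by move/eqP; rewrite lead_coef_eq0 => /eqP ->; rewrite size_poly0.
Qed.

(** * Levels and products below a key polynomial *)

Section Levels.
Variables (K : fieldType) (L : porderZmodType) (hL : ordered_divisible_group L).
Variables (v : K -> option L) (nu : {poly K} -> option L).
Hypotheses (hv : field_valuation v) (hnu : poly_valuation v nu).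
Implicit Types (f g h Q R : {poly K}) (b c x y e : L).

(** This is $\epsilon_\nu(f) < e$ cleared of denominators; it is vacuous when [nu f] is infinite. *)
Definition level_below e f : Prop :=
  forall x, nu f = Some x -> forall s, (0 < s)%N -> ogt (x - e *+ s) (nu f^`N(s)).

(** In the Leibniz rule one of the orders [i] and [s - i] is positive, and that factor makes the
    bound strict. *)
Lemma level_belowM e f g :
  level_below e f -> level_below e g -> level_below e (f * g).
Proof.
move=> hf hg z; rewrite (nuM hnu).
case ef: (nu f) => [x|] //; case eg: (nu g) => [y|] //= [<-] s s0.
have hi h t : level_below e h -> nu h = Some t -> forall i, oge (t - e *+ i) (nu h^`N(i)).
  move=> hh eh [|i]; first by rewrite nderivn0 eh oge_some subr0.
  by apply: ogtW; apply: hh.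
rewrite nderivnM; apply: (ogt_nu_sum hnu) => i _.
have -> : x + y - e *+ s = (x - e *+ i) + (y - e *+ (s - i)).
  have {1}-> : s = (i + (s - i))%N by rewrite subnKC // -ltnS.
  by move: (s - i)%N => t; zring.
case: (posnP i) => [->|i0].
  rewrite subn0; apply: (ogt_nuMr hL hnu); first exact: (hi _ _ hf ef 0%N).
  exact: hg.
by apply: (ogt_nuM hL hnu); [apply: hf | apply: hi].
Qed.

Lemma level_belowX e f n : level_below e 1 -> level_below e f -> level_below e (f ^+ n).
Proof.
by move=> h1 hf; elim: n => [|n IHn] //; rewrite exprS; apply: level_belowM.
Qed.

(** Here [e] is the level of [Q], attained at order [s0], and [x] is its value. *)
Definition key_level Q e x s0 : Prop :=
  [/\ (0 < s0)%N, nu Q = Some x, nu Q^`N(s0) = Some (x - e *+ s0),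
      (forall s, oge (x - e *+ s) (nu Q^`N(s))) &
      (forall f, (size f < size Q)%N -> level_below e f)].

Lemma key_levelP Q : (1 < size Q)%N -> key_poly nu Q -> exists e x s0, key_level Q e x s0.
Proof.
move=> Q1 [_ hQ].
(* Comparing with the polynomial 0 already gives that [nu Q] is finite and that some derivative of
   positive order has finite value. *)
have [|s1 [x [b1 [s1_gt0 ex eb1 _]]]] := hQ 0; first by rewrite size_poly0 ltnW.
(* The maximum defining the level is built order by order; divisibility of [L] supplies each
   quotient. *)
have hN N : (forall s, (0 < s < N)%N -> nu Q^`N(s) = None) \/
    exists e s0, [/\ (0 < s0)%N, nu Q^`N(s0) = Some (x - e *+ s0) &
       forall s, (0 < s < N)%N -> oge (x - e *+ s) (nu Q^`N(s))].
  elim: N => [|N IHN]; first by left=> s; rewrite ltn0 andbF.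
  case: (posnP N) => [->|N0]; first by left=> -[].
  case eN: (nu Q^`N(N)) => [b|]; last first.
    case: IHN => [h|[e [s0 [h0 h1 h2]]]]; [left|right; exists e, s0; split=> //] => s;
    rewrite ltnS [(s <= N)%N]leq_eqVlt => /andP[s_gt0 /orP[/eqP->|sN]]; rewrite ?eN //.
      by apply: h; rewrite s_gt0.
    by apply: h2; rewrite s_gt0.
  have [y ey] := og_div hL (x - b) N0.
  have eb : b = x - y *+ N by rewrite ey opprB addrC subrK.
  right; case: IHN => [h|[e [s0 [h0 h1 h2]]]].
    exists y, N; split; rewrite ?eN ?eb // => s.
    rewrite ltnS [(s <= N)%N]leq_eqVlt => /andP[s_gt0 /orP[/eqP->|sN]].
      by rewrite eN eb oge_some.
    by rewrite h ?s_gt0.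
  case: (og_leP hL y e) => hye.
    exists e, s0; split=> // s.
    rewrite ltnS [(s <= N)%N]leq_eqVlt => /andP[s_gt0 /orP[/eqP->|sN]]; last first.
      by apply: h2; rewrite s_gt0.
    by rewrite eN eb oge_some; og_by hL ((e - y) *+ N).
  exists y, N; split; rewrite ?eN ?eb // => s.
  rewrite ltnS [(s <= N)%N]leq_eqVlt => /andP[s_gt0 /orP[/eqP->|sN]].
      by rewrite eN eb oge_some.
  have := h2 s; rewrite s_gt0 sN => /(_ isT); apply: oge_trans.
  by og_by hL ((y - e) *+ s).
have zero s : (size Q <= s)%N -> nu Q^`N(s) = None.
  by move=> h; rewrite nderivn_poly0 // (nu0 hnu).
have s1Q : (s1 < size Q)%N by case: ltnP => // /zero; rewrite eb1.
case: (hN (size Q)) => [/(_ s1)|[e [s0 [h0 h1 h2]]]]; first by rewrite s1_gt0 s1Q eb1 => /(_ isT).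
have h3 s : oge (x - e *+ s) (nu Q^`N(s)).
  case: s => [|s]; first by rewrite nderivn0 ex oge_some subr0.
  by case: (ltnP s.+1 (size Q)) => hs; [apply: h2 | rewrite zero].
exists e, x, s0; split=> // f hf y ey s s_gt0.
have [s' [x' [b [s'0 ex' eb hlt]]]] := hQ f hf.
move: ex'; rewrite ex => -[ex']; rewrite -{x'}ex' in hlt.
case ec: (nu f^`N(s)) => [c|] //; rewrite ogt_some.
have := hlt s y c s_gt0 ey ec.
have := h3 s'; rewrite eb oge_some => hb hyc.
have : (y - c) *+ s' < (e *+ s) *+ s'.
  by apply: lt_le_trans hyc _; og_by hL ((b - (x - e *+ s')) *+ s).
move/(og_mulrn_lt hL) => h; by og_by hL (e *+ s - (y - c)).
Qed.

(** Only the Leibniz term with [f] underived attains the least value, because deriving [f] loses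
    strictly less than [e] per order. *)
Lemma nderivn_mul_key Q e x s0 f y : key_level Q e x s0 -> level_below e f ->
  nu f = Some y -> nu (f * Q)^`N(s0) = Some (y + x - e *+ s0).
Proof.
move=> [s0_gt0 eQ es0 hs _] hf ey; rewrite nderivnM big_ord_recl nderivn0 subn0.
have e0 : nu (f * Q^`N(s0)) = Some (y + x - e *+ s0).
  by rewrite (nuM hnu) ey es0 /= addrA.
apply: (nuD_eq hL hnu e0).
apply: (ogt_nu_sum hnu) => i _; rewrite lift0.
have -> : y + x - e *+ s0 = (y - e *+ i.+1) + (x - e *+ (s0 - i.+1)).
  by rewrite -{1}(subnKC (ltn_ord i)); move: (s0 - i.+1)%N => t; zring.
by apply: (ogt_nuM hL hnu); first exact: hf.
Qed.

Lemma nu_sum_distinct (t : nat -> {poly K}) n :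
  (forall i j x, (i < j)%N -> nu (t i) = Some x -> nu (t j) <> Some x) ->
  forall i, (i < n)%N -> leo (nu (\sum_(i < n) t i)) (nu (t i)).
Proof.
move=> hd.
(* The induction also records that a finite value of the sum is the value of one term, so that it
   differs from that of the next term. *)
suff: (nu (\sum_(i < n) t i) = None \/
        exists2 k, (k < n)%N & nu (\sum_(i < n) t i) = nu (t k)) /\
  forall i, (i < n)%N -> leo (nu (\sum_(i < n) t i)) (nu (t i)) by case.
elim: n => [|n [IH1 IH2]]; first by rewrite big_ord0 (nu0 hnu); split=> //; left.
rewrite big_ord_recr /=; set S := \sum_(i < n) t i in IH1 IH2 *.
have caseR x : nu (t n) = Some x -> ogt x (nu S) ->
    nu (S + t n) = Some x /\ forall i, (i < n.+1)%N -> leo (nu (S + t n)) (nu (t i)).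
  move=> en hS; have e : nu (S + t n) = Some x by rewrite addrC; apply: (nuD_eq hL hnu).
  rewrite e; split=> // i; rewrite ltnS leq_eqVlt => /orP[/eqP->|/IH2 hi].
    by rewrite en leo_refl.
  by apply: leo_trans (ogtW hS) hi.
have caseL x : nu S = Some x -> ogt x (nu (t n)) ->
    nu (S + t n) = Some x /\ forall i, (i < n.+1)%N -> leo (nu (S + t n)) (nu (t i)).
  move=> eS hn; have e : nu (S + t n) = Some x by apply: (nuD_eq hL hnu).
  rewrite e; split=> // i; rewrite ltnS leq_eqVlt => /orP[/eqP->|/IH2]; last by rewrite eS.
  exact: ogtW.
case eS: (nu S) => [x|]; last first.
  case en: (nu (t n)) => [y|].
    have [|e1 e2] := caseR y en; first by rewrite eS.
    by split=> //; right; exists n; rewrite // e1 en.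
  have e : nu (S + t n) = None.
    have [_ _ _ /(_ S (t n)) hD _] := hnu; move: hD; rewrite eS en.
    by case: (nu _).
  split; first by left.
  move=> i; rewrite e ltnS leq_eqVlt => /orP[/eqP->|/IH2]; first by rewrite en.
  by rewrite eS.
case: IH1 => [|[k kn ek]]; first by rewrite eS.
have ekx : nu (t k) = Some x by rewrite -ek.
case: (boolP (ogt x (nu (t n)))) => [hn|/(ogtPn hL)[y en yx]].
  have [e1 e2] := caseL x eS hn; split=> //; right; exists k; first exact: leqW.
  by rewrite e1.
have [|e1 e2] := caseR y en; last by split=> //; right; exists n; rewrite // e1 en.
rewrite eS ogt_some lt_neqAle yx andbT; apply/eqP => exy.
by apply: (hd k n x kn ekx); rewrite en exy.
Qed.

(** Induction on the degree, using that [Q] has larger level than anything of lower degree. A value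
    of [g] outside $\Gamma$ would bound the level of [Q] through its [g]-expansion; an infinite one
    would bound the values of $K^*$ from below. *)
Lemma nu_below_key Q e x s0 : key_level Q e x s0 ->
  forall f, f != 0 -> (size f < size Q)%N -> exists2 y, nu f = Some y & Gamma v y.
Proof.
move=> hQ f; move: {2}(size f) (leqnn (size f)) => k; elim: k f => [|k IHk] g hgk g0 hg.
  by move: hgk g0; rewrite leqn0 size_poly_eq0 => ->.
have IH h : h != 0 -> (size h < size g)%N -> exists2 y, nu h = Some y & Gamma v y.
  by move=> h0 hh; apply: IHk => //; lia.
have [g1|g1] := leqP (size g) 1.
  move: g0; rewrite (size1_polyC g1) polyC_eq0 => c0.
  have [y ey] := nu_const_finite hv hnu c0; exists y => //.
  by exists 1%N, (g`_0); split=> //; rewrite -(nuC hnu) ey.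
have [s0_gt0 eQ es0 hs hlow] := hQ.
have lowg : level_below e g by apply: hlow.
have size_qc i : (size (qcoef g Q i) < size g)%N by apply: size_qcoef.
case eg: (nu g) => [y|].
  exists y => //; apply: NNPP => nGy; exfalso.
  pose t i := qcoef g Q i * g ^+ i.
  have nut i : t i = 0 \/ exists2 z, nu (t i) = Some (z + y *+ i) & Gamma v z.
    case: (eqVneq (qcoef g Q i) 0) => [e0|/IH/(_ (size_qc i))[z ez Gz]].
      by left; rewrite /t e0 mul0r.
    by right; exists z => //; rewrite (nuM hnu) ez (nuX hnu _ eg).
  (* Equal values of two terms would put a positive multiple of [y] into $\Gamma$. Hence no term of
     the [g]-expansion of [Q] has value below that of [Q]. *)
  have hd i j z : (i < j)%N -> nu (t i) = Some z -> nu (t j) <> Some z.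
    move=> ij; case: (nut i) => [->|[zi -> Gi]]; first by rewrite (nu0 hnu).
    case: (nut j) => [->|[zj -> Gj]]; first by rewrite (nu0 hnu).
    case=> <- [eij]; apply: nGy; apply: (@Gamma_div _ _ v y (j - i)); first by lia.
    have -> : y *+ (j - i) = zi - zj.
      rewrite mulrnBr; last exact: ltnW.
      by apply/eqP; rewrite subr_eq addrAC eq_sym subr_eq -eij addrC.
    exact: (GammaB hv hnu).
  have defQ : Q = \sum_(i < size Q) t i by apply: qcoef_expansion.
  suff: ogt (x - e *+ s0) (nu Q^`N(s0)) by rewrite es0 ogt_some ltxx.
  rewrite {1}defQ linear_sum; apply: (ogt_nu_sum hnu) => i _.
  have := nu_sum_distinct hd (ltn_ord i); rewrite -defQ eQ.
  have lowt : level_below e (t i).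
    apply: level_belowM; first by apply: hlow; apply: ltn_trans (size_qc _) hg.
    by apply: level_belowX => //; apply: hlow; rewrite size_poly1; apply: ltn_trans g1 hg.
  case: (nut i) => [->|[z ez _]]; first by rewrite linear0 (nu0 hnu).
  rewrite ez => xz; apply: ogt_trans (lowt _ ez _ s0_gt0).
  by og_by hL ((z + y *+ i) - x).
exfalso.
(* With [nu g] infinite, a finite value is that of the remainder modulo [g], which has smaller
   degree. *)
have allG f z : nu f = Some z -> Gamma v z.
  have e1 : nu (f %/ g * g) = None by rewrite (nuM hnu) eg; case: (nu _).
  case: (eqVneq (f %% g) 0) => [e0|/IH]; first by rewrite {1}(divp_eq f g) e0 addr0 e1.
  rewrite ltn_modp => /(_ g0)[w ew Gw]; rewrite {1}(divp_eq f g) addrC.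
  by rewrite (nuD_eq hL hnu ew) ?e1 // => -[<-].
have Ge : Gamma v e.
  apply: (@Gamma_div _ _ v e s0) => //.
  have -> : e *+ s0 = x - (x - e *+ s0) by rewrite opprB addrC subrK.
  by apply: (GammaB hv hnu); apply: allG; eauto.
pose n := (size g).-1; have n0 : (0 < n)%N by rewrite /n; case: (size g) g1 => [|[]].
(* Adding a multiple of [g] to 1 keeps the value 0, while the derivative of order $n = \deg g$
   becomes an arbitrary nonzero constant [c]. *)
have bound (c : K) : c != 0 -> ogt (- (e *+ n)) (v c).
  move=> c0; pose d := c / lead_coef g.
  have ecg : nu (d *: g) = None by rewrite -mul_polyC (nuM hnu) eg; case: (nu _).
  have ef : nu (1 + d *: g) = Some 0 by apply: (nuD_eq hL hnu); rewrite ?(nu1 hnu) ?ecg.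
  have sf : (size (1 + d *: g)%R < size Q)%N.
    apply: leq_ltn_trans hg; apply: leq_trans (size_polyD _ _) _.
    by rewrite size_poly1 geq_max ltnW //= size_scale_leq.
  have := hlow _ sf _ ef n n0; rewrite sub0r nderivnD linearZ /= nderivn_lead.
  rewrite -[1]/(1%:P) nderivnC gtn_eqF // add0r -mul_polyC -polyCM /d divfK ?lead_coef_eq0 //.
  by rewrite (nuC hnu).
have epos : 0 < e.
  have := bound 1 (oner_neq0 _); case: hv => _ -> _ _; rewrite ogt_some => h.
  by apply: (@og_mulrn_lt _ hL n); rewrite mul0rn; og_by hL (0 - - (e *+ n)).
(* Some positive multiple of $-ne$ is the value of an element of $K$, which the bound forbids since
   $e > 0$. *)
have [j [a [j0 ea]]] := GammaN hv (GammaMn hv hnu n Ge).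
have a0 : a != 0 by apply/eqP => a0; have [/(_ a)[_ /(_ a0)]] := hv; rewrite ea.
have := bound a a0; rewrite ea ogt_some; case: j j0 ea => // j _ _ /lt_geF.
by case/negP; og_by hL (e *+ n *+ j).
Qed.

(** Write $fg = qQ + r$. If $\nu(qQ) \le b + c$, then the derivatives of order [s0] of $fg$ and of
    $r$ both have value above $\nu(qQ) - s_0 e$, which is exactly the value of that of $qQ$. *)
Lemma key_mul_divmod Q e x s0 : key_level Q e x s0 -> forall f g b c,
  (size f < size Q)%N -> (size g < size Q)%N -> oge b (nu f) -> oge c (nu g) ->
  oge (b + c) (nu ((f * g) %% Q)) /\ ogt (b + c - x) (nu ((f * g) %/ Q)).
Proof.
move=> hQ f g b c sf sg hf hg; set G := f * g.
have [s0_gt0 eQ es0 hs hlow] := hQ.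
have Q0 : Q != 0 by rewrite -size_poly_gt0; apply: leq_ltn_trans sf.
have hG : oge (b + c) (nu G) by apply: (oge_nuM hL hnu).
set q := G %/ Q; set r := G %% Q; have eG : G = q * Q + r by apply: divp_eq.
have sr : (size r < size Q)%N by rewrite ltn_modp.
have sq : (size q < size Q)%N.
  rewrite /q size_divp //; have := size_polyMleq f g; rewrite -/G.
  by move: (size Q) (size f) (size g) (size G) sf sg => *; lia.
case: (eqVneq q 0) => [q0|q0].
  by move: hG; rewrite eG q0 mul0r add0r (nu0 hnu).
have [u eu _] := nu_below_key hQ q0 sq.
have nuqQ : nu (q * Q) = Some (u + x) by rewrite (nuM hnu) eu eQ.
have er : r = G - q * Q by rewrite eG addrC addKr.
case: (og_leP hL (u + x) (b + c)) => hux; last first.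
  split; last by rewrite eu ogt_some; og_by hL (u + x - (b + c)).
  by rewrite er; apply: (oge_nuB hL hnu) => //; rewrite nuqQ oge_some ltW.
have derbound h : (h != 0 -> exists y, nu h = Some y) -> level_below e h ->
    oge (u + x) (nu h) -> ogt (u + x - e *+ s0) (nu h^`N(s0)).
  move=> hfin hh; case: (eqVneq h 0) => [->|/hfin[y ey]]; first by rewrite linear0 (nu0 hnu).
  rewrite ey oge_some => hy; apply: ogt_trans (hh _ ey _ s0_gt0).
  by og_by hL (y - (u + x)).
have rfin : r != 0 -> exists y, nu r = Some y.
  by move=> r0; have [y ey _] := nu_below_key hQ r0 sr; exists y.
have Gfin : G != 0 -> exists y, nu G = Some y.
  rewrite mulf_eq0 negb_or => /andP[f0 g0].
  have [y ey _] := nu_below_key hQ f0 sf; have [z ez _] := nu_below_key hQ g0 sg.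
  by exists (y + z); rewrite (nuM hnu) ey ez.
have dG : ogt (u + x - e *+ s0) (nu G^`N(s0)).
  apply: derbound => //; first by apply: level_belowM; apply: hlow.
  exact: oge_trans hG.
have dr : ogt (u + x - e *+ s0) (nu r^`N(s0)).
  apply: derbound => //; first exact: hlow.
  rewrite er; apply: (oge_nuB hL hnu); first exact: oge_trans hG.
  by rewrite nuqQ oge_some.
have := ogt_nuB hL hnu dG dr; rewrite -linearB /= {1}eG addrK.
by rewrite (nderivn_mul_key hQ (hlow _ sq) eu) ogt_some ltxx.
Qed.

(* Carrying out a product modulo [R] costs less than the value [x] of any
   key polynomial below [R] of the same degree, not just [nu R]. *)
Definition carry_margin R x : Prop := forall f g b c,
  (size f < size R)%N -> (size g < size R)%N -> oge b (nu f) -> oge c (nu g) ->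
  oge (b + c) (nu ((f * g) %% R)) /\ ogt (b + c - x) (nu ((f * g) %/ R)).

(** With $a = R - Q$ and $q$ the quotient by $R$, the quotient of $fg$ by $Q$ is $q$ plus the
    quotient of $qa$ by $Q$. The latter has value above $\nu(q)$, so the bound for division by $Q$
    passes to $q$. *)
Lemma key_carry_margin Q R x y : key_poly nu Q -> key_poly nu R -> (1 < size Q)%N ->
  size Q = size R -> nu Q = Some x -> nu R = Some y -> x <= y -> carry_margin R x.
Proof.
move=> kQ kR Q1 sQR ex ey xy f g b c sf sg hf hg.
have [e [x' [s hQ]]] := key_levelP Q1 kQ.
have [e2 [y' [s2 hR]]] : exists e y s0, key_level R e y s0 by apply: key_levelP; rewrite -?sQR.
have exx : x' = x by case: hQ => _; rewrite ex => -[].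
have eyy : y' = y by case: hR => _; rewrite ey => -[].
rewrite {x'}exx in hQ; rewrite {y'}eyy in hR.
have [hr hq] := key_mul_divmod hR sf sg hf hg; split=> //.
set G := f * g in hr hq *; set q := G %/ R in hq *; set r := G %% R in hr.
case: (eqVneq q 0) => [->|q0]; first by rewrite (nu0 hnu).
have R0 : R != 0 by rewrite -size_poly_gt0; apply: leq_ltn_trans sf.
have Q0 : Q != 0 by rewrite -size_poly_gt0 ltnW.
have sr : (size r < size Q)%N by rewrite sQR ltn_modp.
have sq : (size q < size Q)%N.
  rewrite /q size_divp // sQR; have := size_polyMleq f g; rewrite -/G.
  by move: (size R) (size f) (size g) (size G) sf sg => *; lia.
pose a := R - Q; have sa : (size a < size Q)%N.
  by case: kQ kR => mQ _ [mR _]; rewrite sQR; apply: size_monicB.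
have ha : oge x (nu a) by apply: (oge_nuB hL hnu); rewrite ?ex ?ey oge_some.
have [u eu _] := nu_below_key hQ q0 sq.
have [||_ h1] := key_mul_divmod hQ _ _ hf hg; rewrite ?sQR //.
have hu : oge u (nu q) by rewrite eu oge_some.
have [_ h2] := key_mul_divmod hQ sq sa hu ha.
have eq1 : (f * g) %/ Q = q + (q * a) %/ Q.
  rewrite -/G (divp_eq G R) -/q -/r.
  have -> : q * R + r = (q + (q * a) %/ Q) * Q + ((q * a) %% Q + r).
    by rewrite mulrDl -addrA [X in _ = _ + X]addrA -(divp_eq (q * a) Q) /a; ring.
  rewrite divp_addl_mul_small //; apply: leq_ltn_trans (size_polyD _ _) _.
  by rewrite gtn_max sr ltn_modp Q0.
move: h1; rewrite eq1 (nuD_eq hL hnu eu); last by move: h2; rewrite addrK.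
by rewrite eu.
Qed.
End Levels.

(** * Weights of expansions and change of key polynomial *)

Section WeightedExpansion.
Variables (K : fieldType) (L : porderZmodType) (hL : ordered_divisible_group L).
Variables (v : K -> option L) (nu : {poly K} -> option L).
Hypotheses (hnu : poly_valuation v nu).
Variables (R : {poly K}) (x : L).
Hypotheses (R1 : (1 < size R)%N) (hR : carry_margin nu R x)
  (hfin : forall f : {poly K}, f != 0 -> (size f < size R)%N -> exists y, nu f = Some y).
Implicit Types (f g a t : {poly K}) (b c y : L).

Let R0 : R != 0. Proof. by rewrite -size_poly_gt0 ltnW. Qed.

(** The power [R ^+ i] has weight [x *+ i], where [x] is the carry margin and not the value of [R];
    in use [x] is the value of an earlier key polynomial. *)
Definition weight_ge b f : Prop := forall i, oge (b - x *+ i) (nu (qcoef R f i)).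

(* [t] is the coefficient of [R ^+ n] of the part of weight [b] of [f], and that
   part has [R]-degree at most [n]. *)
Definition weight_lead b n t f : Prop :=
  [/\ weight_ge b f, forall i, (n < i)%N -> ogt (b - x *+ i) (nu (qcoef R f i)) &
      ogt (b - x *+ n) (nu (qcoef R f n - t))].

(** The margin handles weak bounds; a strict one follows by taking the exact value of [f], finite by
    [hfin]. *)
Lemma carry_modp_gt f g b c : (size f < size R)%N -> (size g < size R)%N ->
  ogt b (nu f) -> oge c (nu g) -> ogt (b + c) (nu ((f * g) %% R)).
Proof.
move=> sf sg hf hg; case: (eqVneq f 0) => [->|f0]; first by rewrite mul0r mod0p (nu0 hnu).
have [y ey] := hfin f0 sf; move: hf; rewrite ey ogt_some => hby.
have hy : oge y (nu f) by rewrite ey oge_some.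
by have [h _] := hR sf sg hy hg; apply: oge_ogt h; og_by hL (y - b).
Qed.

Lemma weight_geD b f g : weight_ge b f -> weight_ge b g -> weight_ge b (f + g).
Proof. by move=> hf hg i; rewrite qcoefD; apply: (oge_nuD hnu). Qed.

Lemma weight_geN b f : weight_ge b f -> weight_ge b (- f).
Proof. by move=> hf i; rewrite qcoefN (nuN hL hnu). Qed.

Lemma weight_ge_sum I (r : seq I) (P : pred I) b (F : I -> {poly K}) :
  (forall i, P i -> weight_ge b (F i)) -> weight_ge b (\sum_(i <- r | P i) F i).
Proof. by move=> h i; rewrite qcoef_sum; apply: (oge_nu_sum hnu) => j /h. Qed.

Lemma weight_geMn b f n : weight_ge b f -> weight_ge b (f *+ n).
Proof.
by move=> hf i; rewrite -mulr_natr -polyC_natr mulrC mul_polyC qcoefZ -mul_polyC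
  polyC_natr mulrC mulr_natr; apply: (oge_nuMn hnu).
Qed.

Lemma weight_ge_small b t : (size t < size R)%N -> oge b (nu t) -> weight_ge b t.
Proof.
by move=> st ht [|i]; rewrite qcoef_small // ?subr0 // (nu0 hnu).
Qed.

(** A carry loses less than [x], and moving up one place pays [x] back. *)
Lemma weight_geM b y f a : weight_ge b f -> (size a < size R)%N -> oge y (nu a) ->
  weight_ge (b + y) (f * a).
Proof.
move=> hf sa ha i; rewrite qcoef_mul_small //; apply: (oge_nuD hnu).
  rewrite addrAC.
  by have [h _] := hR (size_qcoef f i R0) sa (hf i) ha.
case: i => [|j]; first by rewrite (nu0 hnu).
have [_ /ogtW h] := hR (size_qcoef f j R0) sa (hf j) ha.
by apply: oge_trans h; apply: og_le_eq; zring.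
Qed.

Lemma weight_geMX b y f a n : weight_ge b f -> (size a < size R)%N -> oge y (nu a) ->
  weight_ge (b + y *+ n) (f * a ^+ n).
Proof.
move=> hf sa ha; elim: n => [|n IHn]; first by rewrite mulr0n addr0 mulr1.
by rewrite exprSr mulrA mulrSr addrA; apply: weight_geM.
Qed.

(** Multiplying by [R] shifts the leading part by one place. The product with [a] reaches place
    [n.+1] only through a carry or an already strict coefficient, hence with excess weight. *)
Lemma weight_leadM b n t f a : weight_lead b n t f -> (size a < size R)%N ->
  oge x (nu a) -> weight_lead (b + x) n.+1 t (f * (R - a)).
Proof.
move=> [h1 h2 h3] sa ha.
have e j : b + x - x *+ j.+1 = b - x *+ j by zring.
have carry j : ogt (b - x *+ j) (nu ((qcoef R f j * a) %/ R)).
  have [_ h] := hR (size_qcoef f j R0) sa (h1 j) ha.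
  by apply: ogt_trans h; apply: og_le_eq; zring.
have low j : (n < j)%N -> ogt (b + x - x *+ j) (nu ((qcoef R f j * a) %% R)).
  move=> nj; rewrite addrAC; apply: carry_modp_gt => //; first exact: size_qcoef.
  exact: h2.
split.
- rewrite mulrBr; apply: weight_geD; last by apply/weight_geN/weight_geM.
  case=> [|j]; first by rewrite qcoef_mulR0 (nu0 hnu).
  by rewrite qcoef_mulRS // e.
- case=> // j; rewrite ltnS => nj; rewrite mulrBr qcoefB qcoef_mulRS // qcoef_mul_small //.
  rewrite e; apply: (ogt_nuB hL hnu); first exact: h2.
  by apply: (ogt_nuD hnu) => //; rewrite -e low // ltnW.
rewrite mulrBr qcoefB qcoef_mulRS // qcoef_mul_small // e [X in nu X]addrAC.
apply: (ogt_nuB hL hnu) => //; apply: (ogt_nuD hnu) => //.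
by rewrite -e low.
Qed.

Lemma weight_lead_small b t : (size t < size R)%N -> oge b (nu t) -> weight_lead b 0 t t.
Proof.
move=> st ht; split; first exact: weight_ge_small.
  by case=> // i _; rewrite qcoef_small // (nu0 hnu).
by rewrite qcoef_small // subrr (nu0 hnu).
Qed.

Lemma weight_leadMX b t a j : (size t < size R)%N -> (size a < size R)%N ->
  oge b (nu t) -> oge x (nu a) -> weight_lead (b + x *+ j) j t (t * (R - a) ^+ j).
Proof.
move=> st sa ht ha; elim: j => [|j IHj].
  by rewrite mulr0n addr0 mulr1; apply: weight_lead_small.
by rewrite exprSr mulrA mulrSr addrA; apply: weight_leadM.
Qed.

(** Each term of the [Q]-expansion is rewritten with $Q = R - (R - Q)$. Terms beyond [n] have excess
    weight, and those before [n] contribute only excess weight at place [n]. *)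
Lemma weight_lead_change (Q f : {poly K}) b n :
  size Q = size R -> (size (R - Q)%R < size R)%N ->
  oge x (nu (R - Q)) ->
  (forall j, oge (b - x *+ j) (nu (qcoef Q f j))) ->
  (forall j, (n < j)%N -> ogt (b - x *+ j) (nu (qcoef Q f j))) ->
  weight_lead b n (qcoef Q f n) f.
Proof.
move=> sQ sa ha h1 h2.
have Q1 : (1 < size Q)%N by rewrite sQ.
have Q0 : Q != 0 by rewrite -size_poly_gt0 ltnW.
pose t j := qcoef Q f j; pose T j := t j * Q ^+ j.
have st j : (size (t j) < size R)%N by rewrite -sQ size_qcoef.
have lead c j : oge c (nu (t j)) -> weight_lead (c + x *+ j) j (t j) (T j).
  by move=> hc; have := weight_leadMX j (st j) sa hc ha; rewrite subKr.
(* The range includes [n] even beyond [size f], so that the term [T n] can be singled out. *)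
have defF : f = \sum_(j < (maxn (size f) n).+1) T j.
  by apply: qcoef_expansion => //; rewrite leqW // leq_maxl.
have gtT j i : (n < j)%N -> ogt (b - x *+ i) (nu (qcoef R (T j) i)).
  move=> nj; case: (eqVneq (t j) 0) => [e0|t0].
    by rewrite /T e0 mul0r qcoef0 (nu0 hnu).
  have [y ey] := hfin t0 (st j); have := h2 _ nj; rewrite -/(t j) ey ogt_some => hy.
  have [|h _ _] := lead y j; first by rewrite ey oge_some.
  by apply: oge_ogt (h i); og_by hL (y - (b - x *+ j)).
have leT j : weight_lead b j (t j) (T j).
  by have := lead _ j (h1 j); rewrite subrK.
have geT j i : oge (b - x *+ i) (nu (qcoef R (T j) i)) by have [h _ _] := leT j; apply: h.
split.
- by move=> i; rewrite defF qcoef_sum; apply: (oge_nu_sum hnu).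
- move=> i ni; rewrite defF qcoef_sum; apply: (ogt_nu_sum hnu) => j _.
  case: (ltnP n j) => nj; first exact: gtT.
  by have [_ h _] := leT j; apply: h; apply: leq_ltn_trans ni.
have nb : (n < (maxn (size f) n).+1)%N by rewrite ltnS leq_maxr.
rewrite {1}defF qcoef_sum (bigD1 (Ordinal nb)) //= addrAC; apply: (ogt_nuD hnu).
  by have [_ _] := leT n.
apply: (ogt_nu_sum hnu) => j /eqP jn.
case: (ltngtP j n) => nj; first by have [_ h _] := leT j; apply: h.
  exact: gtT.
by case: jn; apply: val_inj.
Qed.
End WeightedExpansion.

(** * The truncation $\nu_Q$ and the degree $\deg_Q$ *)

Section Truncation.
Variables (K : fieldType) (L : porderZmodType) (hL : ordered_divisible_group L).
Variables (v : K -> option L) (nu : {poly K} -> option L).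
Hypotheses (hnu : poly_valuation v nu).
Implicit Types (f g Q : {poly K}) (b c x M : L).

Lemma big_mino n (F : 'I_n -> option L) :
  (forall i, leo (\big[@mino L/None]_(i < n) F i) (F i)) /\
  (\big[@mino L/None]_(i < n) F i = None \/
   exists i, \big[@mino L/None]_(i < n) F i = F i).
Proof.
elim: n F => [|n IHn] F; first by rewrite big_ord0; split; [case | left].
rewrite big_ord_recl; have [h1 h2] := IHn (fun i => F (lift ord0 i)).
set B := (X in mino _ X) in h1 h2 *; split.
  move=> i; case: (unliftP ord0 i) => [j|] ->; last exact: (mino_lel hL).
  exact: leo_trans (mino_ler _ _) (h1 j).
rewrite /mino; case: ifP => _; first by right; exists ord0.
by case: h2 => [eB|[j eB]]; [left | right; exists (lift ord0 j)].
Qed.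

(** This removes the range [i < size f] from the minimum: coefficients beyond it vanish. *)
Lemma nuQP Q x f M : (1 < size Q)%N -> nu Q = Some x -> nuQ nu Q f = Some M <->
  (forall i, oge (M - x *+ i) (nu (qcoef Q f i))) /\
  (exists i, nu (qcoef Q f i) = Some (M - x *+ i)).
Proof.
move=> Q1 eQ; pose T i := nu (qcoef Q f i * Q ^+ i).
have TE i : T i = addo (nu (qcoef Q f i)) (Some (x *+ i)).
  by rewrite /T (nuM hnu) (nuX hnu _ eQ).
have Tge i c : oge c (T i) = oge (c - x *+ i) (nu (qcoef Q f i)).
  rewrite TE; case: (nu _) => //= y; rewrite !oge_some -(og_subge0 hL) -[RHS](og_subge0 hL).
  by congr (_ <= _); zring.
have TS i c : T i = Some c <-> nu (qcoef Q f i) = Some (c - x *+ i).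
  rewrite TE; case: (nu _) => //= y; split=> -[] => [<-|->]; last by rewrite subrK.
  by rewrite addrK.
have [h1 h2] := big_mino (fun i : 'I_(size f) => T i); rewrite -/(nuQ nu Q f) in h1 h2.
split=> [eM|[hge [i hi]]].
  split=> [i|].
    rewrite -Tge; case: (ltnP i (size f)) => hi; first by have := h1 (Ordinal hi); rewrite eM.
    by rewrite /T (qcoef_ge_size Q1 hi) mul0r (nu0 hnu).
  case: h2 => [|[i]]; rewrite eM // => /esym/TS h; by exists i.
have ifs : (i < size f)%N.
  by case: ltnP => // h; move: hi; rewrite (qcoef_ge_size Q1 h) (nu0 hnu).
have := h1 (Ordinal ifs); rewrite (TS i M).2 //; case: h2 => [->|[j ->]] //.
by have := hge j; rewrite -Tge; case: (T j) => //= y; rewrite oge_some => ? ?;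
  congr Some; apply/le_anti/andP.
Qed.

Lemma nuQ_None Q x f : (1 < size Q)%N -> nu Q = Some x -> nuQ nu Q f = None ->
  forall i, nu (qcoef Q f i) = None.
Proof.
move=> Q1 eQ eN i; case: (ltnP i (size f)) => hi; last first.
  by rewrite (qcoef_ge_size Q1 hi) (nu0 hnu).
have [/(_ (Ordinal hi))] := big_mino (fun i : 'I_(size f) => nu (qcoef Q f i * Q ^+ i)).
rewrite -/(nuQ nu Q f) eN /= (nuM hnu) (nuX hnu _ eQ); by case: (nu _).
Qed.

Lemma nuQZ Q x f M (c : K) u : (1 < size Q)%N -> nu Q = Some x -> nu c%:P = Some u ->
  nuQ nu Q f = Some M -> nuQ nu Q (c *: f) = Some (u + M).
Proof.
move=> Q1 eQ eu /(nuQP f M Q1 eQ)[h1 [k h2]]; apply/(nuQP _ _ Q1 eQ).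
split=> [i|]; last by exists k; rewrite qcoefZ -mul_polyC (nuM hnu) eu h2 /= addrA.
rewrite qcoefZ -mul_polyC -addrA; apply: (oge_nuM hL hnu) => //.
by rewrite eu oge_some.
Qed.

Lemma degQP Q x f M : (1 < size Q)%N -> nu Q = Some x -> nuQ nu Q f = Some M ->
  nu (qcoef Q f (degQ nu Q f)) = Some (M - x *+ degQ nu Q f) /\
  forall i, (degQ nu Q f < i)%N -> ogt (M - x *+ i) (nu (qcoef Q f i)).
Proof.
move=> Q1 eQ eM; have [hge [k hk]] := (nuQP f M Q1 eQ).1 eM.
have TS i : (nu (qcoef Q f i * Q ^+ i) == nuQ nu Q f) <->
            nu (qcoef Q f i) = Some (M - x *+ i).
  rewrite eM (nuM hnu) (nuX hnu _ eQ); case: (nu _) => //= y.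
  split=> [/eqP[<-]|[->]]; by rewrite ?addrK ?subrK.
have small i : nu (qcoef Q f i) = Some (M - x *+ i) -> (i < size f)%N.
  by move=> hi; case: ltnP => // h; move: hi; rewrite (qcoef_ge_size Q1 h) (nu0 hnu).
split.
  apply/TS; rewrite /degQ; have kf := small _ hk.
  have /TS k' := hk.
  have : (0 < #|[pred i : 'I_(size f) | nu (qcoef Q f i * Q ^+ i) == nuQ nu Q f]|)%N.
    by apply/card_gt0P; exists (Ordinal kf).
  by case/(eq_bigmax_cond (fun i : 'I_(size f) => i : nat)) => j hj ->.
move=> i; apply: contraTT => /(ogtPn hL)[y ey hy]; rewrite -leqNgt.
have hi : nu (qcoef Q f i) = Some (M - x *+ i).
  rewrite ey; congr Some; apply/le_anti; rewrite hy /=.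
  by have := hge i; rewrite ey oge_some.
have /TS hT := hi.
exact: (@leq_bigmax_cond _ _ (fun i : 'I_(size f) => i : nat) (Ordinal (small _ hi))).
Qed.

Lemma nu_nuQ_deg0 Q x f M : (1 < size Q)%N -> nu Q = Some x -> nuQ nu Q f = Some M ->
  degQ nu Q f = 0%N -> nu f = Some M.
Proof.
move=> Q1 eQ eM d0; have [] := degQP Q1 eQ eM; rewrite d0 subr0 => h0 hi.
rewrite (qcoef_expansion Q1 (leqnSn (size f))) big_ord_recl mulr1.
apply: (nuD_eq hL hnu h0); apply: (ogt_nu_sum hnu) => i _; rewrite lift0.
rewrite -[M](subrK (x *+ i.+1)); apply: (ogt_nuM hL hnu); first exact: hi.
by rewrite (nuX hnu _ eQ) oge_some.
Qed.

Lemma degQ_leq Q x f M n : (1 < size Q)%N -> nu Q = Some x -> nuQ nu Q f = Some M ->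
  (forall i, (n < i)%N -> ogt (M - x *+ i) (nu (qcoef Q f i))) -> (degQ nu Q f <= n)%N.
Proof.
move=> Q1 eQ eM h; have [h1 _] := degQP Q1 eQ eM.
by rewrite leqNgt; apply/negP => /h; rewrite h1 ogt_some ltxx.
Qed.
End Truncation.

Lemma ltn_addSn i n : (i < n)%N -> exists j, n = (i + j.+1)%N.
Proof. by move=> h; exists (n - i.+1)%N; rewrite addnS -addSn subnKC. Qed.

(** * Cofinal families of key polynomials of fixed degree *)

Section KeyFamily.
Variables (K : fieldType) (L : porderZmodType) (hL : ordered_divisible_group L).
Variables (v : K -> option L) (hv : field_valuation v).
Variables (nu : {poly K} -> option L) (hnu : poly_valuation v nu).
Variables (m : nat) (hm : (0 < m)%N).
Hypotheses (hPsi_ne : exists Q, Psi nu m Q)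
  (hPsi_nomax : forall Q, Psi nu m Q -> exists R, Psi nu m R /\ lto (nu Q) (nu R)).
Variable (Qs : {poly K} -> Prop).
Hypotheses (hQs_sub : forall Q, Qs Q -> Psi nu m Q)
  (hQs_cof : forall P, Psi nu m P -> exists Q, Qs Q /\ leo (nu P) (nu Q)).
Implicit Types (f g P Q R S T : {poly K}) (b x y M : L).

(** The default 0 is never met on key polynomials of degree [m], by [Psi_gam]. *)
Definition gam Q : L := odflt 0 (nu Q).

Lemma Psi_size Q : Psi nu m Q -> size Q = m.+1.
Proof. by case=> _ e; move: hm; rewrite -e; case: (size Q). Qed.

Lemma Psi_gam Q : Psi nu m Q -> nu Q = Some (gam Q).
Proof.
move=> hQ; have [|e [x [s [_ ex _ _ _]]]] := @key_levelP _ _ hL _ _ hnu Q _ hQ.1.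
  by rewrite (Psi_size hQ) ltnS.
by rewrite /gam ex.
Qed.

Lemma Qs_size Q : Qs Q -> size Q = m.+1.
Proof. by move/hQs_sub/Psi_size. Qed.

Lemma Qs_size_gt1 Q : Qs Q -> (1 < size Q)%N.
Proof. by move/Qs_size ->; rewrite ltnS. Qed.

Lemma Qs_gam Q : Qs Q -> nu Q = Some (gam Q).
Proof. by move/hQs_sub/Psi_gam. Qed.

Lemma Qs_leo Q R : Qs Q -> Qs R -> leo (nu Q) (nu R) = (gam Q <= gam R).
Proof. by move=> hQ hR; rewrite (Qs_gam hQ) (Qs_gam hR). Qed.

Lemma Qs_nonempty : exists Q, Qs Q.
Proof. by have [Q /hQs_cof[R [hR _]]] := hPsi_ne; exists R. Qed.

Lemma Qs_nomax Q : Qs Q -> exists2 R, Qs R & gam Q < gam R.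
Proof.
move=> hQ; have [P [hP hQP]] := hPsi_nomax (hQs_sub hQ).
have [R [hR hPR]] := hQs_cof hP; exists R => //.
rewrite -ogt_some -(Qs_gam hR); apply: ogt_leo hPR.
by move: hQP; rewrite (Qs_gam hQ).
Qed.

Lemma Qs_max Q R : Qs Q -> Qs R -> exists S, [/\ Qs S, gam Q <= gam S & gam R <= gam S].
Proof.
by move=> hQ hR; case/orP: (og_le_total hL (gam Q) (gam R)) => h; [exists R | exists Q].
Qed.

Lemma Qs_max_lt Q R : Qs Q -> Qs R -> exists S, [/\ Qs S, gam Q < gam S & gam R < gam S].
Proof.
move=> hQ hR; have [S [hS h1 h2]] := Qs_max hQ hR; have [T hT h3] := Qs_nomax hS.
by exists T; split=> //; [apply: le_lt_trans h3 | apply: le_lt_trans h3].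
Qed.

Lemma nu_small f : f != 0 -> (size f < m.+1)%N -> exists2 y, nu f = Some y & Gamma v y.
Proof.
move=> f0 sf; have [Q hQ] := Qs_nonempty.
have [e [x [s h]]] := key_levelP hL hnu (Qs_size_gt1 hQ) (hQs_sub hQ).1.
by apply: (nu_below_key hL hv hnu h); rewrite ?(Qs_size hQ).
Qed.

Lemma nu_small_Gamma f y : (size f < m.+1)%N -> nu f = Some y -> Gamma v y.
Proof.
move=> sf ey; case: (eqVneq f 0) => [e0|f0]; first by move: ey; rewrite e0 (nu0 hnu).
by have [z] := nu_small f0 sf; rewrite ey => -[->].
Qed.

Lemma size_QsB Q R : Qs Q -> Qs R -> (size (R - Q)%R < size R)%N.
Proof.
move=> hQ hR; have [[mQ _] _] := hQs_sub hQ; have [[mR _] _] := hQs_sub hR.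
by apply: size_monicB => //; rewrite (Qs_size hQ) (Qs_size hR).
Qed.

Lemma size_qcoef_Qs Q f i : Qs Q -> (size (qcoef Q f i) < m.+1)%N.
Proof.
move=> hQ; rewrite -(Qs_size hQ); apply: size_qcoef.
by rewrite -size_poly_gt0 (Qs_size hQ).
Qed.

(** For a later [R], the value of [Q] is that of [R - Q], whose degree is below [m]. *)
Lemma Gamma_gam Q : Qs Q -> Gamma v (gam Q).
Proof.
move=> hQ; have [R hR hQR] := Qs_nomax hQ.
apply: (@nu_small_Gamma (R - Q)); first by rewrite -(Qs_size hR); apply: size_QsB.
rewrite addrC; apply: (nuD_eq hL hnu);
  by rewrite ?(nuN hL hnu) ?(Qs_gam hQ) ?(Qs_gam hR) ?ogt_some.
Qed.

Lemma Qs_carry_margin Q R : Qs Q -> Qs R -> gam Q <= gam R -> carry_margin nu R (gam Q).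
Proof.
move=> hQ hR hQR; have [kQ _] := hQs_sub hQ; have [kR _] := hQs_sub hR.
apply: (key_carry_margin hL hv hnu kQ kR (Qs_size_gt1 hQ) _ (Qs_gam hQ) (Qs_gam hR)) => //.
by rewrite (Qs_size hQ) (Qs_size hR).
Qed.

Lemma Qs_change Q R f b n : Qs Q -> Qs R -> gam Q <= gam R ->
  (forall j, oge (b - gam Q *+ j) (nu (qcoef Q f j))) ->
  (forall j, (n < j)%N -> ogt (b - gam Q *+ j) (nu (qcoef Q f j))) ->
  weight_lead nu R (gam Q) b n (qcoef Q f n) f.
Proof.
move=> hQ hR hQR h1 h2.
apply: (weight_lead_change hL hnu (Qs_size_gt1 hR) (Qs_carry_margin hQ hR hQR)) => //.
- by move=> g g0; rewrite (Qs_size hR) => sg; have [y ey _] := nu_small g0 sg; exists y.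
- by rewrite (Qs_size hQ) (Qs_size hR).
- exact: size_QsB.
by apply: (oge_nuB hL hnu); rewrite ?(Qs_gam hQ) ?(Qs_gam hR) oge_some.
Qed.

Lemma nuQ_finite Q f : Qs Q -> f != 0 -> exists2 M, nuQ nu Q f = Some M & Gamma v M.
Proof.
move=> hQ f0; have Q1 := Qs_size_gt1 hQ; have eQ := Qs_gam hQ.
case eM: (nuQ nu Q f) => [M|]; last first.
  exfalso; case/eqP: f0; rewrite [LHS](@qcoef_expansion _ Q f (size f)) // big1 // => i _.
  case: (eqVneq (qcoef Q f i) 0) => [->|q0]; first by rewrite mul0r.
  have [y] := nu_small q0 (size_qcoef_Qs f i hQ).
  by rewrite (nuQ_None hL hnu Q1 eQ eM).
exists M => //; have [_ [i hi]] := (nuQP hL hnu f M Q1 eQ).1 eM.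
rewrite -[M](subrK (gam Q *+ i)); apply: (GammaD hv hnu).
  exact: nu_small_Gamma (size_qcoef_Qs f i hQ) hi.
by apply: (GammaMn hv hnu); apply: Gamma_gam.
Qed.

Lemma nuQ_le Q R f M N : Qs Q -> Qs R -> gam Q <= gam R ->
  nuQ nu Q f = Some M -> nuQ nu R f = Some N -> M <= N.
Proof.
move=> hQ hR hQR eM eN.
have [h1 _] := (nuQP hL hnu f M (Qs_size_gt1 hQ) (Qs_gam hQ)).1 eM.
have [_ h2] := degQP hL hnu (Qs_size_gt1 hQ) (Qs_gam hQ) eM.
have [h3 _ _] := Qs_change hQ hR hQR h1 h2.
have [_ [i hi]] := (nuQP hL hnu f N (Qs_size_gt1 hR) (Qs_gam hR)).1 eN.
have := h3 i; rewrite hi oge_some => h.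
by og_by hL ((N - gam R *+ i - (M - gam Q *+ i)) + (gam R - gam Q) *+ i).
Qed.

(** The leading part survives the change to [R], so the coefficient at $d = \deg_Q f$ keeps its
    value. Beyond [d], raising the value of the key polynomial only increases the excess over the
    term at [d]. *)
Lemma degQ_step Q R f : Qs Q -> Qs R -> gam Q <= gam R -> f != 0 ->
  (degQ nu R f <= degQ nu Q f)%N /\
  nu (qcoef R f (degQ nu Q f)) = nu (qcoef Q f (degQ nu Q f)).
Proof.
move=> hQ hR hQR f0.
have [M eM _] := nuQ_finite hQ f0; have [N eN _] := nuQ_finite hR f0.
have [h1 _] := (nuQP hL hnu f M (Qs_size_gt1 hQ) (Qs_gam hQ)).1 eM.
have [h0 h2] := degQP hL hnu (Qs_size_gt1 hQ) (Qs_gam hQ) eM.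
have [h3 h4 h5] := Qs_change hQ hR hQR h1 h2.
set d := degQ nu Q f in h0 h2 h4 h5 *.
have ed : nu (qcoef R f d) = Some (M - gam Q *+ d) by apply: (nu_near hL hnu h0).
split; last by rewrite ed h0.
apply: (degQ_leq hL hnu (Qs_size_gt1 hR) (Qs_gam hR) eN) => i di.
have [h6 _] := (nuQP hL hnu f N (Qs_size_gt1 hR) (Qs_gam hR)).1 eN.
have := h6 d; rewrite ed oge_some => h; apply: ogt_trans (h4 i di).
rewrite -(subnKC (ltnW di)); move: (i - d)%N => k.
by og_by hL ((M - gam Q *+ d - (N - gam R *+ d)) + (gam R - gam Q) *+ k).
Qed.

Lemma degQ_ultimate f : f != 0 -> exists Q, Qs Q /\
  forall R, Qs R -> gam Q <= gam R -> degQ nu R f = degQ nu Q f.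
Proof.
move=> f0; have [Q hQ] := Qs_nonempty.
move: {2}(degQ nu Q f) (leqnn (degQ nu Q f)) => k; elim: k Q hQ => [|k IHk] Q hQ hk.
  exists Q; split=> // R hR hQR; have [h _] := degQ_step hQ hR hQR f0.
  by apply/eqP; rewrite eqn_leq h (leq_trans hk).
case: (classic (exists2 R, Qs R & (degQ nu R f <= k)%N)) => [[R hR /(IHk _ hR)] //|hn].
exists Q; split=> // R hR hQR; have [h _] := degQ_step hQ hR hQR f0.
apply/eqP; rewrite eqn_leq h (leq_trans hk) // ltnNge; apply/negP => hle.
by apply: hn; exists R.
Qed.

(** Once $\nu_Q(f)$ has become constant, equal to $M$, a later $R$ cannot attain it at a place $i >
    0$: the coefficient would have value $M - i\gamma_R$, less than the bound $M - i\gamma_Q$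
    inherited from $Q$. *)
Lemma stable_qcoef0 f : stable nu Qs f -> exists2 Q, Qs Q &
  forall R, Qs R -> gam Q < gam R -> nu (qcoef R f 0) = nu f.
Proof.
move=> [Q [hQ hst]]; exists Q => // R hR hQR.
case: (eqVneq f 0) => [->|f0]; first by rewrite qcoef0.
have [M eM _] := nuQ_finite hQ f0.
have eR : nuQ nu R f = Some M.
  by rewrite hst ?Qs_leo ?ltW // -(hst Q hQ) // Qs_leo.
have eF : nu f = Some M by rewrite -(hst Q hQ) // Qs_leo.
have [h1 _] := (nuQP hL hnu f M (Qs_size_gt1 hQ) (Qs_gam hQ)).1 eM.
have [_ h2] := degQP hL hnu (Qs_size_gt1 hQ) (Qs_gam hQ) eM.
have [h3 _ _] := Qs_change hQ hR (ltW hQR) h1 h2.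
have [_ [i hi]] := (nuQP hL hnu f M (Qs_size_gt1 hR) (Qs_gam hR)).1 eR.
case: i hi => [|i] hi; first by rewrite hi subr0 eF.
exfalso; have := h3 i.+1; rewrite hi oge_some => h.
suff /lt_geF : M - gam R *+ i.+1 < M - gam Q *+ i.+1 by rewrite h.
by og_by hL ((gam R - gam Q) *+ i.+1).
Qed.

(* Iterating the failure of vertical boundedness for one ratio [q > 1] yields every
   integer factor [N]. *)
Lemma vert_unboundedP : vert_unbounded v nu Qs -> exists2 Q, Qs Q &
  forall R S N, Qs R -> Qs S -> gam Q <= gam R ->
    exists2 T, Qs T & (gam S - gam R) *+ N < gam T - gam R.
Proof.
move=> hvu.
(* Here $p/D$ is the ratio $q > 1$ at which boundedness fails, and [x] the base point. *)
have [x [[_ [Q [hQ hxQ]]] [p [D [D0 Dp step]]]]] : exists x, gammaQs_L v nu Qs x /\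
    exists p D : nat, [/\ (0 < D)%N, (D < p)%N & forall P, Qs P ->
      exists2 Z, Qs Z & (gam P - x) *+ p <= (gam Z - x) *+ D].
  have [x /not_all_ex_not[hx /not_all_ex_not[q /not_all_ex_not[q1 hq]]]] :=
    not_all_ex_not _ _ hvu.
  exists x; split=> //; exists `|numq q|%N, `|denq q|%N.
  have dlt : denq q < numq q.
    move: q1; rewrite -{1}(divq_num_den q) ltr_pdivlMr ?ltr0z ?denq_gt0 //.
    by rewrite mul1r ltr_int.
  have dgt0 := denq_gt0 q.
  split; [by lia | by lia | move=> P hP].
  have := not_ex_all_not _ _ hq (gam P) => hz.
  have hPL : gammaQs_L v nu Qs (gam P).
    by split; [apply: Gamma_gam | exists P; rewrite (Qs_gam hP) /= lexx].
  have [z hzz] := not_all_ex_not _ _ (fun h => hz (conj hPL h)).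
  have [[_ [Z [hZ zZ]]] hz'] := imply_to_and _ _ hzz.
  exists Z => //; move: zZ; rewrite (Qs_gam hZ) /= => zZ.
  have en : numq q = Posz `|numq q|%N by lia.
  have ed : denq q = Posz `|denq q|%N by lia.
  move: hz'; rewrite {1}en {1}ed -!pmulrn => hz'.
  have : (gam P - x) *+ `|numq q|%N <= (z - x) *+ `|denq q|%N.
    by case: (og_leP hL ((gam P - x) *+ `|numq q|%N) ((z - x) *+ `|denq q|%N)).
  move=> h; apply: le_trans h _; by og_by hL ((gam Z - z) *+ `|denq q|%N).
move: hxQ; rewrite (Qs_gam hQ) /= => hxQ.
have grow P : Qs P -> x <= gam P -> exists Z, [/\ Qs Z, gam P <= gam Z &
    gam P - x <= (gam Z - gam P) *+ D].
  move=> hP hx; have [Z hZ h] := step P hP.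
  have h' : gam P - x <= (gam Z - gam P) *+ D.
    have [k ek] := ltn_addSn Dp; move: h; rewrite ek => h.
    by og_by hL (((gam Z - x) *+ D - (gam P - x) *+ (D + k.+1)) + (gam P - x) *+ k).
  exists Z; split=> //; apply: (@og_mulrn_le _ hL D) => //.
  by og_by hL (((gam Z - gam P) *+ D - (gam P - x)) + (gam P - x)).
(* Each growth step gains at least $(\gamma_P - x)/D$, since it starts no nearer to [x] than [P]. *)
have iter P : Qs P -> x <= gam P -> forall k, exists Z, [/\ Qs Z, gam P <= gam Z &
    (gam P - x) *+ k <= (gam Z - gam P) *+ D].
  move=> hP hx; elim=> [|k [Z [hZ hPZ hk]]].
    by exists P; split=> //; rewrite subrr mul0rn mulr0n.
  have [W [hW hZW h]] := grow Z hZ (le_trans hx hPZ).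
  exists W; split=> //; first exact: le_trans hZW.
  by og_by hL (((gam Z - gam P) *+ D - (gam P - x) *+ k) +
    ((gam W - gam Z) *+ D - (gam Z - x)) + (gam Z - gam P)).
exists Q => // R S N hR hS hQR; have [S' [hS' h1 h2]] := Qs_max_lt hR hS.
have hxS : x <= gam S' by apply: le_trans hxQ (le_trans hQR (ltW h1)).
have [Z [hZ hSZ hk]] := iter S' hS' hxS (N * D)%N.
have {}hk : (gam S' - x) *+ N <= gam Z - gam S'.
  by apply: (@og_mulrn_le _ hL D) => //; rewrite -mulrnA.
exists Z => //; have hxR := le_trans hxQ hQR.
by og_by hL ((gam S' - gam R) + (gam Z - gam S' - (gam S' - x) *+ N) +
  (gam S' - gam S) *+ N + (gam R - x) *+ N).
Qed.

(** * Limit key polynomials *)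

Section LimitKeyPolynomial.
Variable F : {poly K}.
Hypothesis hF : KP_inf nu Qs F.

Let F0 : F != 0. Proof. by case: hF => /monic_neq0. Qed.

(** Minimality of [F] concerns monic polynomials only; dividing by the leading coefficient shifts
    $\nu$ and every $\nu_Q$ by the same amount. *)
Lemma stable_small g : (size g < size F)%N -> stable nu Qs g.
Proof.
move=> sg; case: (eqVneq g 0) => [->|g0].
  have [Q hQ] := Qs_nonempty; exists Q; split=> // R _ _.
  by rewrite /nuQ size_poly0 big_ord0 (nu0 hnu).
apply: NNPP => ng; pose c := (lead_coef g)^-1.
have c0 : c != 0 by rewrite invr_eq0 lead_coef_eq0.
have [u eu] := nu_const_finite hv hnu c0.
have [_ _ /(_ (c *: g))] := hF; rewrite size_scale // leqNgt sg => h.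
suff : ~~ true by [].
apply: h; first by rewrite monicE lead_coefZ mulVf // lead_coef_eq0.
move=> [Q [hQ hst]]; apply: ng; exists Q; split=> // R hR hQR.
have [M eM _] := nuQ_finite hR g0; have := hst R hR hQR.
rewrite (nuQZ hL hnu (Qs_size_gt1 hR) (Qs_gam hR) eu eM) -mul_polyC (nuM hnu) eu eM.
by case: (nu g) => //= y [/addrI ->].
Qed.

(** * The index set $B$ compared with the ultimate degree *)

Section Ultimate.
Variables (d : nat) (bd : L) (Q' : {poly K}).
Hypotheses (hQ' : Qs Q') (d_gt0 : (0 < d)%N).
Hypothesis hult : forall R, Qs R -> gam Q' <= gam R ->
  [/\ nu (qcoef R F d) = Some bd, nuQ nu R F = Some (bd + gam R *+ d) &
      forall i, oge (bd + gam R *+ d - gam R *+ i) (nu (qcoef R F i))].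

Lemma ultimate_Gamma R : Qs R -> gam Q' <= gam R -> Gamma v (bd + gam R *+ d).
Proof.
move=> hR hle; have [_ e _] := hult hR hle.
by have [M eM GM] := nuQ_finite hR F0; move: eM; rewrite e => -[->].
Qed.

Lemma deltaLP x : deltaL v nu Qs F x <->
  Gamma v x /\ exists R, [/\ Qs R, gam Q' <= gam R & x <= bd + gam R *+ d].
Proof.
split=> -[Gx [R]].
  move=> [hR hx]; split=> //; have [S [hS hRS hQS]] := Qs_max hR hQ'.
  exists S; split=> //; have [_ eS _] := hult hS hQS.
  have [M eM _] := nuQ_finite hR F0; move: hx; rewrite eM /= => /le_trans; apply.
  exact: nuQ_le eM eS.
move=> [hR hle hx]; split=> //; exists R; split=> //.
by have [_ -> _] := hult hR hle.
Qed.

(** The usable form of membership in $B$: at some [R] as late as desired, the term at [l] is at most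
    some $\nu_S(F)$. *)
Lemma Bset_cofinal l Q : Bset v nu m Qs F l -> Qs Q ->
  exists R S b, [/\ Qs R, gam Q <= gam R, nu (qcoef R F l) = Some b,
    Qs S & gam Q' <= gam S /\ b + gam R *+ l <= bd + gam S *+ d].
Proof.
move=> [lD nJ] hQ; apply: NNPP => hn; apply: nJ; split=> //.
exists Q; split=> // R hR; rewrite Qs_leo // => hQR.
rewrite /beta (Qs_gam hR); case eb: (nu (qcoef R F l)) => [b|] //=; split.
  apply: (GammaD hv hnu); first exact: nu_small_Gamma (size_qcoef_Qs F l hR) eb.
  by apply: (GammaMn hv hnu); apply: Gamma_gam.
by move/deltaLP => [_ [S [hS h1 h2]]]; apply: hn; exists R, S, b.
Qed.

Lemma Bct_degree : Bct v nu m Qs F d.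
Proof.
have eb R : Qs R -> leo (nu Q') (nu R) -> beta nu F R d = Some bd.
  by move=> hR; rewrite Qs_leo // => h; have [] := hult hR h.
split; last by exists Q'; split=> // R hR hle; rewrite !eb // leo_refl.
split.
  rewrite leqNgt /Dbound ltn_divLR //; apply/negP => h.
  have := eb Q' hQ' (leo_refl _); rewrite /beta qcoef_eq0 ?(nu0 hnu) // ?Qs_size_gt1 //.
  by rewrite (Qs_size hQ') /= mulnC.
move=> [_ [Q [hQ hab]]]; have [S [hS hQS hQS']] := Qs_max hQ hQ'.
have := hab S hS; rewrite Qs_leo // => /(_ hQS).
rewrite eb ?Qs_leo // (Qs_gam hS) /= => -[GS]; apply.
by apply/deltaLP; split=> //; exists S.
Qed.

(** If the constant value is [b], then $b + l\gamma_R \le \nu_S(F)$ for some [S]. For a later [T],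
    $\nu_T(F) - l\gamma_R$ lies in $\mathcal B_l$ and exceeds [b], because $d > 0$. *)
Lemma Bct_notin_Bunb l : Bct v nu m Qs F l -> ~ Bunb v nu m Qs F l.
Proof.
move=> [hB [Q [hQ hct]]] [_ hunb].
have [R [S [b [hR hQR eb hS [hS' hle]]]]] := Bset_cofinal hB hQ.
have [T hT hST] := Qs_nomax hS; have hT' := le_trans hS' (ltW hST).
have GT := ultimate_Gamma hT hT'.
have [|P [hP hge]] := hunb (bd + gam T *+ d - gam R *+ l).
  have Gb : Gamma v (bd + gam T *+ d - gam R *+ l).
    by apply: (GammaB hv hnu) => //; apply: (GammaMn hv hnu); apply: Gamma_gam.
  split=> //; exists (bd + gam T *+ d - gam R *+ l), (gam R), R; split=> //.
    exact: Qs_gam.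
  by rewrite subrK; apply/deltaLP; split=> //; exists T.
have [Z [hZ h1 h2]] := Qs_max hP hQ.
have := hge Z hZ; rewrite Qs_leo // => /(_ h1).
have -> : beta nu F Z l = Some b by rewrite -eb -/(beta nu F R l) !hct // Qs_leo.
rewrite /= => h; suff /lt_geF : b < bd + gam T *+ d - gam R *+ l by rewrite h.
case: d d_gt0 hle => // k _ hle.
by og_by hL ((bd + gam S *+ k.+1 - (b + gam R *+ l)) + (gam T - gam S) *+ k.+1).
Qed.

(* The polynomial [G] is the [l]-th Hasse derivative of the [Q]-expansion of [F]
   with respect to [Q]. It is stable since [l > 0], and [qcoef R G 0] agrees with
   [qcoef R F l] up to carries. *)
Lemma qcoef_near_stable Q0 Q l : Qs Q0 -> Qs Q -> gam Q0 <= gam Q -> gam Q' <= gam Q ->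
  (0 < l)%N -> exists G, stable nu Qs G /\ forall R, Qs R -> gam Q < gam R ->
    oge (bd + gam Q *+ d - gam Q *+ l + (gam Q - gam Q0)) (nu (qcoef R F l - qcoef R G 0)).
Proof.
move=> hQ0 hQ hQ0Q hQ'Q l0; have Q1 := Qs_size_gt1 hQ; have Q_neq0 : Q != 0.
  by rewrite -size_poly_gt0 ltnW.
(* The [Q]-expansion becomes a polynomial in a second variable, so that it can be derived with
   respect to [Q]. *)
pose P : {poly {poly K}} := \poly_(j < size F) qcoef Q F j.
have coefP j : P`_j = qcoef Q F j.
  by rewrite coef_poly; case: ltnP => // h; rewrite qcoef_ge_size.
have evalP : P.[Q] = F by rewrite horner_poly -qcoef_expansion.
exists (P^`N(l)).[Q]; split.
  apply: stable_small; rewrite horner_coef.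
  have F_gt0 : (0 < size F)%N by rewrite size_poly_gt0.
  rewrite -(prednK F_gt0) ltnS; apply: leq_trans (size_sum _ _ _) _.
  apply/bigmax_leqP => j _; rewrite coef_nderivn coefP mulrnAl.
  rewrite -scaler_nat; apply: leq_trans (size_scale_leq _ _) _.
  case: (ltnP (size F).-1 ((size Q).-1 * (l + j))) => h.
    by rewrite qcoef_eq0 // mul0r size_poly0.
  apply: leq_trans (size_polyMleq _ _) _; apply: leq_trans h.
  have := size_poly_exp_leq Q j; have := size_qcoef_Qs F (l + j) hQ.
  rewrite (Qs_size hQ) /=; move: (size _) (size _) => s t; rewrite mulnDr; nia.
move=> R hR hQR; have R_neq0 : R != 0 by rewrite -size_poly_gt0 (Qs_size hR).
(* Taylor expansion of [P] at $-a$ in powers of [R]: the term $k = l$ gives the coefficient of [G],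
   terms $k > l$ do not reach place [l], and terms $k < l$ reach it by carries. *)
pose a := R - Q; have defQ : Q = - a + R by rewrite opprB subrK.
have taylor (p : {poly {poly K}}) n : (size p <= n)%N ->
    p.[Q] = \sum_(k < n) (p^`N(k)).[- a] * R ^+ k.
  by move=> hn; rewrite {1}defQ; apply: nderiv_taylor_wide => //; apply: mulrC.
have qcoefT (p : {poly {poly K}}) n i : (size p <= n)%N ->
    qcoef R p.[Q] i = \sum_(k < n) if (k <= i)%N then qcoef R (p^`N(k)).[- a] (i - k) else 0.
  move=> hn; rewrite (taylor p n hn) qcoef_sum; apply: eq_bigr => k _.
  exact: qcoef_mulRX.
have eG : qcoef R (P^`N(l)).[Q] 0 = qcoef R (P^`N(l)).[- a] 0.
  rewrite (qcoefT _ (size P^`N(l)).+1) // big_ord_recl /= nderivn0.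
  by rewrite big1 ?addr0 // => i _.
have sa : (size (- a)%R < size R)%N by rewrite size_polyN; apply: size_QsB.
have hN : (l < (size P + l).+1)%N by rewrite ltnS leq_addl.
rewrite -{1}evalP (qcoefT _ (size P + l).+1) ?leqW ?leq_addr //.
rewrite (bigD1 (Ordinal hN)) //= leqnn subnn eG [X in nu X]addrAC subrr add0r.
apply: (oge_nu_sum hnu) => k /eqP kl; case: leqP => [kle|_]; last by rewrite (nu0 hnu).
have {}kl : (k < l)%N.
  by rewrite ltn_neqAle kle andbT; apply/eqP => e; apply: kl; apply: val_inj.
have ha : oge (gam Q) (nu (- a)).
  rewrite (nuN hL hnu); apply: (oge_nuB hL hnu); rewrite ?(Qs_gam hQ) ?(Qs_gam hR) oge_some //.
  exact: ltW.
(* Measuring carries by [gam Q0] instead of [gam Q] gains $\gamma_Q - \gamma_{Q_0}$ per place, and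
   at least one place is crossed. *)
have hm0 := Qs_carry_margin hQ0 hR (le_trans hQ0Q (ltW hQR)).
have [_ _ hge] := hult hQ hQ'Q.
have hW : weight_ge nu R (gam Q0) (bd + gam Q *+ d - gam Q *+ k) (P^`N(k)).[- a].
  rewrite horner_coef; apply: (weight_ge_sum hnu) => j _.
  rewrite coef_nderivn coefP mulrnAl; apply: (weight_geMn hnu).
  have -> : bd + gam Q *+ d - gam Q *+ k =
      bd + gam Q *+ d - gam Q *+ (k + j) + gam Q *+ j by zring.
  apply: (weight_geMX hnu (Qs_size_gt1 hR) hm0) => //.
  apply: (weight_ge_small hnu) => //.
  by rewrite (Qs_size hR); apply: size_qcoef_Qs.
apply: oge_trans (hW (l - k)%N).
move: (nat_of_ord k) kl {hW kle} => i il.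
have [j ->] := ltn_addSn il.
rewrite addKn.
by og_by hL ((gam Q - gam Q0) *+ j).
Qed.

Hypothesis hvu : vert_unbounded v nu Qs.

(* If the values of [Qs] do not escape [d] times their distance to the least
   value [gam Q0], then carries lie above [deltaL], which forces [l] out of [B]. *)
Lemma Bset_gap l Q0 Q2 : Qs Q0 -> (forall Q, Qs Q -> gam Q0 <= gam Q) -> Qs Q2 ->
  (forall S, Qs S -> gam S - gam Q0 < (gam Q2 - gam Q0) *+ d) ->
  (0 < l < d)%N -> ~ Bset v nu m Qs F l.
Proof.
move=> hQ0 minQ0 hQ2 hbd /andP[l0 ld] hB.
have [Qx hQx hU] := vert_unboundedP hvu.
have [S1 [hS1 h1 h2]] := Qs_max hQ2 hQ'; have [Q1 [hQ1 h3 h4]] := Qs_max hS1 hQx.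
have h5 : gam Q2 <= gam Q1 by apply: le_trans h3.
have h6 : gam Q' <= gam Q1 by apply: le_trans h3.
(* Some [T] lies beyond $d^2(\gamma_S - \gamma_{Q_1})$ from [Q1], yet within $d(\gamma_{Q_1} -
   \gamma_{Q_0})$ of [Q0]; cancelling one factor [d] leaves the claim. *)
have gap S : Qs S -> (gam S - gam Q1) *+ d < gam Q1 - gam Q0.
  move=> hS; have [T hT hlt] := hU Q1 S (d * d)%N hQ1 hS h4.
  apply: (@og_mulrn_lt _ hL d); have := hbd T hT; have := minQ0 _ hQ1 => h7 h8.
  by og_by hL ((gam T - gam Q1 - (gam S - gam Q1) *+ (d * d)) + (gam Q1 - gam Q0)
    + ((gam Q2 - gam Q0) *+ d - (gam T - gam Q0)) + (gam Q1 - gam Q2) *+ d).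
have [G [stG hG]] := qcoef_near_stable hQ0 hQ1 (minQ0 _ hQ1) h6 l0.
have [Q3 hQ3 h03] := stable_qcoef0 stG.
have [Q4 [hQ4 h14 h34]] := Qs_max_lt hQ1 hQ3.
(* The lower bound for all carries at place [l]; by [gap] it exceeds the value [b] of the
   coefficient found in $B$, which is therefore the value of [G]. *)
pose E := bd + gam Q1 *+ d - gam Q1 *+ l + (gam Q1 - gam Q0).
have [R [S [b [hR h4R eb hS [hS' hle]]]]] := Bset_cofinal hB hQ4.
have bE : b < E.
  have := gap S hS; have := lt_le_trans h14 h4R => h7 h8.
  by rewrite /E; og_by hL ((bd + gam S *+ d - (b + gam R *+ l)) + (gam R - gam Q1) *+ l
    + ((gam Q1 - gam Q0) - (gam S - gam Q1) *+ d)).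
have eG : nu G = Some b.
  rewrite -(h03 R hR (lt_le_trans h34 h4R)); apply: (nu_near hL hnu eb).
  rewrite -(nuN hL hnu) opprB; apply: oge_ogt bE _.
  exact: hG (lt_le_trans h14 h4R).
have [T hT hTlt] := hU R S d hR hS (le_trans h4 (ltW (lt_le_trans h14 h4R))).
have [Z [hZ hRZ hTZ]] := Qs_max hR hT.
have ebZ : nu (qcoef Z F l) = Some b.
  have h4Z := le_trans h4R hRZ.
  apply: (@nu_near _ _ hL _ _ hnu b (qcoef Z G 0)).
    by rewrite h03 // (lt_le_trans h34).
  by apply: oge_ogt bE _; apply: hG => //; apply: lt_le_trans h4Z.
(* Since the coefficient at [Z] still has value [b], $(d-l)(\gamma_Z - \gamma_R) \le d(\gamma_S -
   \gamma_R)$, whereas [T], and hence [Z], was chosen further away than that. *)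
have [_ _ /(_ l)] := hult hZ (le_trans h6 (ltW (lt_le_trans h14 (le_trans h4R hRZ)))).
rewrite ebZ oge_some.
have [j ej] := ltn_addSn ld.
move: hTlt hle; rewrite ej => hTlt hle hZb.
suff : gam T - gam R < gam T - gam R by rewrite ltxx.
by og_by hL ((gam T - gam R - (gam S - gam R) *+ (l + j.+1))
  + (bd + gam S *+ (l + j.+1) - (b + gam R *+ l))
  + (b - (bd + gam Z *+ (l + j.+1) - gam Z *+ l))
  + (gam Z - gam R) *+ j + (gam Z - gam T)).
Qed.

Hypothesis hQs_wo : well_ordered_by_value nu Qs.

Lemma Bset_lt_degree_Bunb l : (l < d)%N -> Bset v nu m Qs F l -> Bunb v nu m Qs F l.
Proof.
move=> ld hB; split=> // b [Gb [b' [g [P [_ hP eg /deltaLP[_ [R [hR hR' hle]]] hbb]]]]].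
have eP : g = gam P by rewrite /gam eg.
rewrite eP in hle.
have [Q0 [hQ0 min0]] := hQs_wo.2 Qs (fun Q h => h) Qs_nonempty.
have minQ0 Q : Qs Q -> gam Q0 <= gam Q by move=> hQ; rewrite -Qs_leo // min0.
have h0P := minQ0 P hP.
case: (posnP l) => [l0|l0].
  exists R; split=> // Z hZ; rewrite Qs_leo // => hRZ.
  have [_ _ /(_ l)] := hult hZ (le_trans hR' hRZ); apply: oge_trans.
  move: hle; rewrite l0 => hle.
  by og_by hL ((b' - b) + (bd + gam R *+ d - (b' + gam P *+ 0)) + (gam Z - gam R) *+ d).
(* Relative to $\gamma_{Q_0}$, the bound $b_d + (d-l)\gamma_Z$ suffices once $\gamma_Z -
   \gamma_{Q_0}$ reaches $d(\gamma_R - \gamma_{Q_0})$, as $d - l \ge 1$. *)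
case: (classic (exists2 S, Qs S & (gam R - gam Q0) *+ d <= gam S - gam Q0)) => [[S hS hRS]|hn].
  have [S' [hS' h1 h2]] := Qs_max hS hR.
  exists S'; split=> // Z hZ; rewrite Qs_leo // => hSZ.
  have [_ _ /(_ l)] := hult hZ (le_trans hR' (le_trans h2 hSZ)); apply: oge_trans.
  have [j ej] := ltn_addSn ld.
  move: hle hRS; rewrite ej => hle hRS; have h0Z := minQ0 _ hZ.
  have hSZ' := le_trans h1 hSZ.
  by og_by hL ((b' - b) + (bd + gam R *+ (l + j.+1) - (b' + gam P *+ l))
    + (gam P - gam Q0) *+ l + (gam S - gam Q0 - (gam R - gam Q0) *+ (l + j.+1))
    + (gam Z - gam S) + (gam Z - gam Q0) *+ j).
case: (@Bset_gap l Q0 R) => //; last by rewrite l0.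
move=> S hS; case: (og_leP hL ((gam R - gam Q0) *+ d) (gam S - gam Q0)) => // h.
by case: hn; exists S.
Qed.
End Ultimate.

Lemma ultimate_degree : exists d bd Q', [/\ Qs Q', (0 < d)%N,
  forall R, Qs R -> gam Q' <= gam R -> degQ nu R F = d &
  forall R, Qs R -> gam Q' <= gam R ->
  [/\ nu (qcoef R F d) = Some bd, nuQ nu R F = Some (bd + gam R *+ d) &
      forall i, oge (bd + gam R *+ d - gam R *+ i) (nu (qcoef R F i))]].
Proof.
have [Q [hQ hd]] := degQ_ultimate F0; set d := degQ nu Q F in hd.
have [M eM _] := nuQ_finite hQ F0.
have [h0 _] := degQP hL hnu (Qs_size_gt1 hQ) (Qs_gam hQ) eM; rewrite -/d in h0.
exists d, (M - gam Q *+ d), Q; split=> //.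
  (* Ultimate degree 0 would let the constant coefficient dominate and make [F] stable. *)
  rewrite lt0n; apply/eqP => d0; have [_ nst _] := hF; apply: nst.
  exists Q; split=> // R hR; rewrite Qs_leo // => hQR.
  have [N eN _] := nuQ_finite hR F0; rewrite eN; symmetry.
  by apply: (nu_nuQ_deg0 hL hnu (Qs_size_gt1 hR) (Qs_gam hR) eN); rewrite hd.
move=> R hR hQR; have [_ eR] := degQ_step hQ hR hQR F0; rewrite -/d h0 in eR.
have [N eN _] := nuQ_finite hR F0.
have [h1 _] := degQP hL hnu (Qs_size_gt1 hR) (Qs_gam hR) eN.
have [h2 _] := (nuQP hL hnu F N (Qs_size_gt1 hR) (Qs_gam hR)).1 eN.
have eNM : N = M - gam Q *+ d + gam R *+ d.
  by move: h1; rewrite hd // eR => -[->]; rewrite subrK.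
by rewrite -eNM.
Qed.
End LimitKeyPolynomial.
End KeyFamily.

Theorem mainTheorem11
  (K : fieldType) (L : porderZmodType) (hL : ordered_divisible_group L)
  (v : K -> option L) (hv : field_valuation v)
  (nu : {poly K} -> option L) (hnu : poly_valuation v nu)
  (hws : well_specified v nu)
  (m : nat) (hm : (0 < m)%N)
  (hPsi_ne : exists Q, Psi nu m Q)
  (hPsi_nomax : forall Q, Psi nu m Q -> exists R, Psi nu m R /\ lto (nu Q) (nu R))
  (Qs : {poly K} -> Prop)
  (hQs_sub : forall Q, Qs Q -> Psi nu m Q)
  (hQs_wo : well_ordered_by_value nu Qs)
  (hQs_cof : forall P, Psi nu m P -> exists Q, Qs Q /\ leo (nu P) (nu Q))
  (hunst : exists f, ~ stable nu Qs f)
  (F : {poly K}) (hF : KP_inf nu Qs F)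
  (hvu : vert_unbounded v nu Qs) :
  exists d : nat,
    [/\ eventually nu Qs (fun Q => degQ nu Q F = d),
        is_min (fun l => Bset v nu m Qs F l /\ ~ Bunb v nu m Qs F l) d &
        is_min (Bct v nu m Qs F) d].
Proof.
have [d [bd [Q' [hQ' d0 hdeg hult]]]] :=
  ultimate_degree hL hv hnu hm hPsi_ne hPsi_nomax hQs_sub hQs_cof hF.
have ct := Bct_degree hL hv hnu hm hPsi_ne hPsi_nomax hQs_sub hQs_cof hF hQ' hult.
have ct_unb l := @Bct_notin_Bunb _ _ hL _ hv _ hnu _ hm hPsi_ne hPsi_nomax _ hQs_sub
  hQs_cof _ hF _ _ _ hQ' d0 hult l.
have unb l := @Bset_lt_degree_Bunb _ _ hL _ hv _ hnu _ hm hPsi_ne hPsi_nomax _ hQs_sub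
  hQs_cof _ hF _ _ _ hQ' d0 hult hvu hQs_wo l.
(* One lower bound serves both minima, because $B^{ct}$ is disjoint from $B^{unb}$. *)
have min_d k : Bset v nu m Qs F k -> ~ Bunb v nu m Qs F k -> (d <= k)%N.
  by move=> hB nunb; rewrite leqNgt; apply/negP => kd; apply: nunb; apply: unb.
exists d; split.
- exists Q'; split=> // R hR hle; apply: hdeg => //.
  by rewrite -(Qs_leo hL hnu hm hQs_sub).
- by split; [split; [case: ct | apply: ct_unb] | move=> k [hB nunb]; apply: min_d].
by split=> // k hk; apply: min_d; [case: hk | apply: ct_unb].
Qed.
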